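(* Let $K$ be a field and let $(X,\sigma)$ be a Deaconu--Renault system with $X$ totally disconnected. The following are equivalent: (1) $X$ is discrete; (2) $G(X,\sigma)$ is discrete; (3) $A_K(G(X,\sigma))$ is categorically Noetherian; (4) $A_K(G(X,\sigma))$ is locally Noetherian.
   Context: A Deaconu--Renault system is a pair $(X,\sigma)$ where $X$ is a locally compact Hausdorff space and $\sigma:\operatorname{dom}(\sigma)\to X$ is a local homeomorphism defined on an open subset $\operatorname{dom}(\sigma)\subseteq X$. Set $\operatorname{dom}(\sigma^0)=X$, $\sigma^0=\mathrm{id}_X$, $\operatorname{dom}(\sigma^{n+1})=\{x\in\operatorname{dom}(\sigma^n):\sigma^n(x)\in\operatorname{dom}(\sigma)\}$ and $\sigma^{n+1}(x)=\sigma(\sigma^n(x))$. The Deaconu--Renault groupoid is $G(X,\sigma)=\{(x,k,y)\in X\times\mathbb Z\times X:\exists\, m,n\ge0,\ k=m-n,\ x\in\operatorname{dom}(\sigma^m),\ y\in\operatorname{dom}(\sigma^n),\ \sigma^m(x)=\sigma^n(y)\}$, with $r(x,k,y)=x$, $s(x,k,y)=y$, $(x,k,y)(y,\ell,z)=(x,k+\ell,z)$, $(x,k,y)^{-1}=(y,-k,x)$, unit space identified with $X$ via $x\leftrightarrow(x,0,x)$, and topology generated by the sets $Z(U,m,n,V)=\{(x,m-n,y): x\in U,\ y\in V,\ \sigma^m(x)=\sigma^n(y)\}$, with $m,n\ge0$ and $U\subseteq\operatorname{dom}(\sigma^m)$, $V\subseteq\operatorname{dom}(\sigma^n)$ open such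 that $\sigma^m|_U$, $\sigma^n|_V$ are homeomorphisms onto their images. When $X$ is totally disconnected this is an ample Hausdorff groupoid. The Steinberg algebra of an ample Hausdorff groupoid $G$ is $A_K(G)=\mathrm{span}_K\{1_U:U\subseteq G\text{ a compact open bisection}\}$ with convolution product, determined by $1_U*1_V=1_{UV}$ (a bisection is a set on which $r$ and $s$ are injective); it is a ring with local units. For a ring $R$ with local units: $R$ is categorically Noetherian if every finitely generated (unital, i.e. $RM=M$) left $R$-module $M$ is Noetherian; $R$ is locally Noetherian if for every finite subset $S\subseteq R$ there is an idempotent $e\in R$ with $S\subseteq eRe$ and $eRe$ left Noetherian. (Left and right versions are equivalent for $A_K(G)$, since inversion in $G$ induces an anti-automorphism.) *)

(* Defs.v *)
From HB Require Import structures.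
From mathcomp Require Import all_boot all_order all_algebra.
From mathcomp Require Import boolp classical_sets functions.
From mathcomp Require Import cardinality fsbigop topology numfun.
From mathcomp Require Import zify.

Set Implicit Arguments.
Unset Strict Implicit.
Unset Printing Implicit Defensive.

Import Order.TTheory GRing.Theory Num.Theory.

Local Open Scope classical_set_scope.
Local Open Scope ring_scope.

Definition discrete_space (T : topologicalType) : Prop :=
  forall A : set T, open A.

Definition homeo_onto_image (T : topologicalType) (f : T -> T) (U : set T) :=
  exists g : T -> T, [/\ {in U, cancel f g}, {within U, continuous f}
                       & {within f @` U, continuous g}].

Definition local_homeo (T : topologicalType) (D : set T) (f : T -> T) :=
  forall x, D x -> exists U : set T,
    [/\ open U, U x, U `<=` D, open (f @` U) & homeo_onto_image f U].

(** The partial map is encoded by a total map [dr_map]; its values outside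
    [dr_dom] are irrelevant. *)
Record drSystem := DRSystem {
  dr_space :> topologicalType;
  dr_dom : set dr_space;
  dr_map : dr_space -> dr_space;
  dr_locally_compact : locally_compact [set: dr_space];
  dr_hausdorff : hausdorff_space dr_space;
  dr_dom_open : open dr_dom;
  dr_map_local_homeo : local_homeo dr_dom dr_map }.

Section Iterates.
Variable S : drSystem.
Local Notation f := (@dr_map S).

Definition dr_iter (n : nat) : S -> S := iter n f.

Fixpoint dr_domn (n : nat) : set S :=
  if n is m.+1 then [set x | dr_domn m x /\ dr_dom (dr_iter m x)] else setT.

Lemma dr_domn_add m n x :
  dr_domn (m + n) x <-> dr_domn m x /\ dr_domn n (dr_iter m x).
Proof.
elim: n => [|n IHn]; first by rewrite addn0; split=> // -[].
rewrite addnS /= IHn.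
have -> : dr_iter (m + n) x = dr_iter n (dr_iter m x).
  by rewrite /dr_iter addnC iterD.
by split=> [[[? ?] ?]|[? [? ?]]].
Qed.

Lemma dr_iter_add m n x : dr_iter (m + n) x = dr_iter n (dr_iter m x).
Proof. by rewrite /dr_iter addnC iterD. Qed.

Lemma dr_map_continuous x : dr_dom x -> {for x, continuous f}.
Proof.
move=> /dr_map_local_homeo[U [oU Ux _ _ [g [_ + _]]]].
by rewrite continuous_open_subspace// => /(_ x); rewrite inE; apply.
Qed.

Lemma dr_map_open x W : dr_dom x -> nbhs x W -> nbhs (f x) (f @` W).
Proof.
move=> /dr_map_local_homeo[U [oU Ux UD ofU [g [fgK _ ctsg]]]] Wx.
move: ctsg; rewrite continuous_open_subspace// => /(_ (f x)).
have fUx : (f x) \in f @` U by rewrite inE; exists x.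
move=> /(_ fUx) gx.
have gW : nbhs (f x) (g @^-1` W).
  by move: gx; rewrite /prop_for /continuous_at fgK ?inE//; apply.
have fU : nbhs (f x) (f @` U).
  by apply: open_nbhs_nbhs; split=> //; exact: set_mem.
apply: filterS (filterI gW fU) => y /= [Wgy [z Uz fzy]].
by exists z => //; move: Wgy; rewrite -fzy /= fgK ?inE.
Qed.

Lemma dr_map_locally_injective x : dr_dom x ->
  exists2 U, nbhs x U & {in U &, injective f}.
Proof.
move=> /dr_map_local_homeo[U [oU Ux UD ofU [g [fgK _ ctsg]]]].
exists U; first exact: open_nbhs_nbhs.
exact: can_in_inj fgK.
Qed.

Lemma dr_iter_continuous n x : dr_domn n x -> {for x, continuous (dr_iter n)}.
Proof.
elim: n => [_|n IHn [xn fx]]; first by move=> A.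
exact: (continuous_comp (IHn xn) (dr_map_continuous fx)).
Qed.

Lemma dr_iter_open n x W : dr_domn n x -> nbhs x W ->
  nbhs (dr_iter n x) (dr_iter n @` W).
Proof.
elim: n => [_|n IHn [xn fx] Wx].
  by apply: filterS => y Wy; exists y.
have := dr_map_open fx (IHn xn Wx).
by apply: filterS => _ [_ [z Wz <-] <-]; exists z.
Qed.

Lemma dr_iter_locally_injective n x : dr_domn n x ->
  exists2 U, nbhs x U & {in U &, injective (dr_iter n)}.
Proof.
elim: n => [_|n IHn [xn fx]].
  by exists setT; [exact: filterT|move=> y z _ _].
have [U Ux injU] := IHn xn; have [V Vx injV] := dr_map_locally_injective fx.
exists (U `&` dr_iter n @^-1` V).
  by apply: filterI => //; exact: dr_iter_continuous Vx.
move=> y z; rewrite !inE => -[Uy Vy] [Uz Vz] fyz.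
by apply: injU; rewrite ?inE//; apply: injV; rewrite ?inE.
Qed.

Lemma dr_domn_open n : open (dr_domn n).
Proof.
elim: n => [|n IHn]; first exact: openT.
rewrite openE => x [xn fx]; apply: filterI.
  exact: open_nbhs_nbhs.
apply: (dr_iter_continuous xn); apply: open_nbhs_nbhs.
by split=> //; exact: dr_dom_open.
Qed.

Lemma dr_iter_homeo n (U : set S) : open U -> U `<=` dr_domn n ->
  {in U &, injective (dr_iter n)} -> homeo_onto_image (dr_iter n) U.
Proof.
move=> oU UD injU.
have [[x0 Ux0]|U0] := pselect (U !=set0); last first.
  have -> : U = set0 by apply: contra_notP U0 => /eqP/set0P.
  exists id; rewrite image_set0; split; first by move=> x; rewrite inE.
  - exact: continuous_subspace0.
  - exact: continuous_subspace0.
pose g y := xget x0 [set x | U x /\ dr_iter n x = y].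
have fgK : {in U, cancel (dr_iter n) g}.
  move=> x /[!inE] Ux; rewrite /g.
  case: xgetP => [y _ [Uy /injU]|/(_ x)[]]; last by [].
  by rewrite !inE; apply.
have ofU : open (dr_iter n @` U).
  rewrite openE => _ [x Ux <-]; apply: dr_iter_open; first exact: UD.
  exact: open_nbhs_nbhs.
exists g; split=> //.
  rewrite continuous_open_subspace// => x /[!inE] Ux.
  exact/dr_iter_continuous/UD.
rewrite continuous_open_subspace// => _ /[!inE] -[x Ux <-] W.
rewrite fgK ?inE// => Wx.
have xU : nbhs x U by exact: open_nbhs_nbhs.
by apply: filterS (dr_iter_open (UD _ Ux) (filterI Wx xU)) => _ [z [Wz Uz] <-]; rewrite /= fgK ?inE.
Qed.

Lemma dr_chart n x W : dr_domn n x -> nbhs x W -> exists U : set S,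
  [/\ open U, U x, U `<=` W, U `<=` dr_domn n
    & {in U &, injective (dr_iter n)}].
Proof.
move=> xn Wx; have [V Vx injV] := dr_iter_locally_injective xn.
have : nbhs x (W `&` V `&` dr_domn n).
  by do 2?apply: filterI => //; apply: open_nbhs_nbhs; split=> //;
     exact: dr_domn_open.
rewrite nbhsE => -[U [oU Ux] UWV]; exists U; split=> //.
- by move=> y /UWV[[]].
- by move=> y /UWV[].
- by move=> y z /[!inE] /UWV[[_ Vy] _] /UWV[[_ Vz] _]; apply: injV; rewrite inE.
Qed.

Lemma homeo_onto_image_inj n U : homeo_onto_image (dr_iter n) U ->
  {in U &, injective (dr_iter n)}.
Proof. by move=> [g [/can_in_inj]]. Qed.

End Iterates.

Section Groupoid.
Variable S : drSystem.

Definition dr_arrow (t : S * int * S) : Prop :=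
  exists m n : nat, [/\ t.1.2 = m%:Z - n%:Z, dr_domn m t.1.1, dr_domn n t.2
                      & dr_iter m t.1.1 = dr_iter n t.2].

Record drGroupoid := DRGroupoid {
  dr_val :> S * int * S;
  dr_valP : `[< dr_arrow dr_val >] }.

HB.instance Definition _ := [isSub for dr_val].
HB.instance Definition _ := [Choice of drGroupoid by <:].

Definition dr_rng (a : drGroupoid) : S := (dr_val a).1.1.
Definition dr_deg (a : drGroupoid) : int := (dr_val a).1.2.
Definition dr_src (a : drGroupoid) : S := (dr_val a).2.

(** [dr_comp a b c] means that [a] and [b] are composable and [c = ab]. *)
Definition dr_comp (a b c : drGroupoid) : Prop :=
  dr_src a = dr_rng b /\
  dr_val c = (dr_rng a, dr_deg a + dr_deg b, dr_src b).

(** The set [Z(U, m, n, V)], indexed by [(U, m, n, V)], and the admissible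
    indices. *)
Definition dr_Zset (i : set S * nat * nat * set S) : set drGroupoid :=
  let: (U, m, n, V) := i in
  [set a | [/\ U (dr_rng a), V (dr_src a), dr_deg a = m%:Z - n%:Z
             & dr_iter m (dr_rng a) = dr_iter n (dr_src a)]].

Definition dr_Zindex : set (set S * nat * nat * set S) :=
  [set i | let: (U, m, n, V) := i in
    [/\ open U /\ open V, U `<=` dr_domn m, V `<=` dr_domn n,
        homeo_onto_image (dr_iter m) U & homeo_onto_image (dr_iter n) V]].

Lemma dr_Zset_around (a : drGroupoid) m n (A B : set S) :
  dr_deg a = m%:Z - n%:Z -> dr_domn m (dr_rng a) -> dr_domn n (dr_src a) ->
  dr_iter m (dr_rng a) = dr_iter n (dr_src a) ->
  nbhs (dr_rng a) A -> nbhs (dr_src a) B ->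
  exists U V, [/\ dr_Zindex (U, m, n, V), dr_Zset (U, m, n, V) a,
                  U `<=` A & V `<=` B].
Proof.
move=> da ma na ea Aa Ba.
have [U [oU Ua UA Um injU]] := dr_chart ma Aa.
have [V [oV Va VB Vn injV]] := dr_chart na Ba.
by exists U, V; split=> //; split=> //; exact: dr_iter_homeo.
Qed.

Lemma dr_Zset_cover : \bigcup_(i in dr_Zindex) dr_Zset i = [set: drGroupoid].
Proof.
rewrite -subTset => a _.
have /asboolP[m [n [da ma na ea]]] := dr_valP a.
have [U [V [UV Za _ _]]] := dr_Zset_around da ma na ea filterT filterT.
by exists (U, m, n, V).
Qed.

Lemma dr_Zset_join i j a : dr_Zindex i -> dr_Zindex j ->
  dr_Zset i a -> dr_Zset j a ->
  exists k, [/\ dr_Zindex k, dr_Zset k a & dr_Zset k `<=` dr_Zset i `&` dr_Zset j].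
Proof.
move: i j => [[[U m] n] V] [[[U' m'] n'] V'].
wlog le_mm' : U m n V U' m' n' V' / (m <= m')%N => [WL|].
  have [/WL|/ltnW/WL WL' Di Dj Zi Zj] := leqP m m'; first exact.
  by rewrite setIC; exact: WL'.
move=> [[oU oV] Um Vn hU hV] [[oU' oV'] Um' Vn' hU' hV'].
move=> [Ua Va da ea] [U'a V'a da' ea'].
have [A [B [AB Za AU BV]]] := dr_Zset_around da (Um _ Ua) (Vn _ Va) ea
  (open_nbhs_nbhs (conj (openI oU oU') (conj Ua U'a)))
  (open_nbhs_nbhs (conj (openI oV oV') (conj Va V'a))).
exists (A, m, n, B); split=> // b [Ab Bb db eb].
have [[Ub U'b] [Vb V'b]] := (AU _ Ab, BV _ Bb).
split; split=> //; first by rewrite db -da.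
have em : m' = (m + (m' - m))%N by lia.
have en : n' = (n + (m' - m))%N by lia.
by rewrite em en !dr_iter_add eb.
Qed.

(** By [dr_Zset_join] the admissible sets [Z(U, m, n, V)] form a base of the
    topology they generate. *)
HB.instance Definition _ :=
  isBaseTopological.Build drGroupoid dr_Zset_cover dr_Zset_join.

End Groupoid.

Section GroupoidTheory.
Variable S : drSystem.
Local Notation G := (drGroupoid S).
Implicit Types (a b c : G) (A B U V W : set G).

Lemma dr_nbhsP a W : nbhs a W ->
  exists i, [/\ dr_Zindex i, dr_Zset i a & dr_Zset i `<=` W].
Proof.
move=> [_ [[D sD <-] [i Di Zia] DW]]; exists i; split=> //; first exact: sD.
by apply: subset_trans DW => b Zib; exists i.
Qed.

Lemma dr_Zset_open i : dr_Zindex i -> open (dr_Zset i : set G).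
Proof.
move=> Zi; rewrite openE => a Zia; exists (dr_Zset i); split=> //.
by exists [set i]; [move=> _ -> //|rewrite bigcup_set1].
Qed.

Lemma dr_Zset_nbhs i a : dr_Zindex i -> dr_Zset i a -> nbhs a (dr_Zset i).
Proof. by move=> /dr_Zset_open oi ia; exact: open_nbhs_nbhs. Qed.

Lemma dr_val_eq a b :
  dr_rng a = dr_rng b -> dr_deg a = dr_deg b -> dr_src a = dr_src b -> a = b.
Proof.
by case: a b => [[[x k] y] ?] [[[x' k'] y'] ?] /= h1 h2 h3; apply: val_inj;
  move: h1 h2 h3; rewrite /dr_rng /dr_deg /dr_src /= => -> -> ->.
Qed.

Lemma dr_arrowK t : dr_arrow t -> exists a, dr_val a = t.
Proof. by move=> /asboolP tP; exists (DRGroupoid tP). Qed.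

Lemma dr_arrow_val a : exists m n : nat,
  [/\ dr_deg a = m%:Z - n%:Z, dr_domn m (dr_rng a), dr_domn n (dr_src a)
    & dr_iter m (dr_rng a) = dr_iter n (dr_src a)].
Proof. exact/asboolP/dr_valP. Qed.

Lemma dr_inv_subproof a : `[< dr_arrow (dr_src a, - dr_deg a, dr_rng a) >].
Proof.
apply/asboolP; have [m [n [da ma na ea]]] := dr_arrow_val a.
by exists n, m; split=> //=; rewrite da opprB.
Qed.

Definition dr_inv a : G := DRGroupoid (dr_inv_subproof a).

Lemma dr_invK : involutive dr_inv.
Proof. by move=> a; apply: dr_val_eq => //; rewrite /dr_deg /= opprK. Qed.

Lemma dr_compE a b c : dr_comp a b c <->
  [/\ dr_src a = dr_rng b, dr_rng c = dr_rng a, dr_deg c = dr_deg a + dr_deg b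
    & dr_src c = dr_src b].
Proof.
case: c => [[[x k] y] ?]; rewrite /dr_comp /dr_rng /dr_deg /dr_src /=.
by split=> [[-> [-> -> ->]]|[-> -> -> ->]].
Qed.

Lemma dr_comp_inv a b c : dr_comp a b c ->
  dr_comp (dr_inv b) (dr_inv a) (dr_inv c).
Proof.
move=> /dr_compE[h1 h2 h3 h4]; apply/dr_compE; split=> //.
by rewrite /dr_deg /= -!/(dr_deg _) h3 opprD addrC.
Qed.

Lemma dr_comp_divr a b c : dr_comp a b c -> dr_comp c (dr_inv b) a.
Proof.
move=> /dr_compE[h1 h2 h3 h4]; apply/dr_compE; split=> //.
by rewrite /dr_deg /= -!/(dr_deg _) h3 addrK.
Qed.

Lemma dr_comp_divl a b c : dr_comp a b c -> dr_comp (dr_inv a) c b.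
Proof.
move=> /dr_compE[h1 h2 h3 h4]; apply/dr_compE; split=> //.
by rewrite /dr_deg /= -!/(dr_deg _) h3 addKr.
Qed.

Lemma dr_comp_uniq a b c c' : dr_comp a b c -> dr_comp a b c' -> c = c'.
Proof. by move=> [_ cE] [_ cE']; apply: val_inj => /=; rewrite cE cE'. Qed.

Lemma dr_comp_uniqr a b b' c : dr_comp a b c -> dr_comp a b' c -> b = b'.
Proof. by move=> /dr_comp_divl + /dr_comp_divl; exact: dr_comp_uniq. Qed.

Lemma dr_comp_uniql a a' b c : dr_comp a b c -> dr_comp a' b c -> a = a'.
Proof. by move=> /dr_comp_divr + /dr_comp_divr; exact: dr_comp_uniq. Qed.

Lemma dr_comp_ex a b : dr_src a = dr_rng b -> exists c, dr_comp a b c.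
Proof.
move=> ab; suff /dr_arrowK[c cE] :
  dr_arrow (dr_rng a, dr_deg a + dr_deg b, dr_src b) by exists c.
have [m [n [da ma na ea]]] := dr_arrow_val a.
have [p [q [db pb qb eb]]] := dr_arrow_val b.
have [np|/ltnW pn] := leqP n p.
  have pE : p = (n + (p - n))%N by lia.
  exists (m + (p - n))%N, q; split=> //=.
  - by rewrite da db; lia.
  - apply/dr_domn_add; split=> //; rewrite ea ab.
    by move: pb; rewrite {1}pE => /dr_domn_add[].
  - by rewrite dr_iter_add ea ab -dr_iter_add -pE.
have nE : n = (p + (n - p))%N by lia.
exists m, (q + (n - p))%N; split=> //=.
- by rewrite da db; lia.
- apply/dr_domn_add; split=> //; rewrite -eb -ab.
  by move: na; rewrite {1}nE => /dr_domn_add[].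
- by rewrite dr_iter_add -eb -ab -dr_iter_add -nE.
Qed.

Lemma dr_compA a b c ab abc : dr_comp a b ab -> dr_comp ab c abc ->
  exists2 bc, dr_comp b c bc & dr_comp a bc abc.
Proof.
move=> /dr_compE[h1 h2 h3 h4] /dr_compE[k1 k2 k3 k4].
have /dr_comp_ex[bc Hbc] : dr_src b = dr_rng c by rewrite -h4.
exists bc => //; move: Hbc => /dr_compE[l1 l2 l3 l4]; apply/dr_compE; split.
- by rewrite h1 l2.
- by rewrite k2.
- by rewrite k3 h3 l3 addrA.
- by rewrite k4.
Qed.

Lemma dr_src_continuous : continuous (@dr_src S).
Proof.
move=> a W Wa; have [m [n [da ma na ea]]] := dr_arrow_val a.
have [U [V [UV Za _ VW]]] := dr_Zset_around da ma na ea filterT Wa.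
by apply: filterS (dr_Zset_nbhs UV Za) => b [_ Vb _ _]; exact: VW.
Qed.

Lemma dr_rng_continuous : continuous (@dr_rng S).
Proof.
move=> a W Wa; have [m [n [da ma na ea]]] := dr_arrow_val a.
have [U [V [UV Za UW _]]] := dr_Zset_around da ma na ea Wa filterT.
by apply: filterS (dr_Zset_nbhs UV Za) => b [Ub _ _ _]; exact: UW.
Qed.

Lemma dr_Zset_inv (X Y : set S) m n a :
  dr_Zset (X, m, n, Y) (dr_inv a) <-> dr_Zset (Y, n, m, X) a.
Proof.
suff dE : dr_deg (dr_inv a) = m%:Z - n%:Z <-> dr_deg a = n%:Z - m%:Z.
  by split=> -[? ? /dE ? e_]; split.
rewrite -(opprB n%:Z); split=> [/oppr_inj //|aE].
by rewrite [LHS]/(- dr_deg a) aE.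
Qed.

Lemma dr_Zindex_inv (X Y : set S) m n :
  dr_Zindex (X, m, n, Y) -> dr_Zindex (Y, n, m, X).
Proof. by move=> [[? ?] ? ? ? ?]; split. Qed.

Lemma dr_inv_continuous : continuous dr_inv.
Proof.
move=> a W Wa; have [[[[X m] n] Y] [XY Za ZW]] := dr_nbhsP Wa.
apply: filterS (dr_Zset_nbhs (dr_Zindex_inv XY) _).
  by move=> b /dr_Zset_inv; exact: ZW.
exact/dr_Zset_inv.
Qed.

Lemma dr_inv_open U : open U -> open (dr_inv @^-1` U).
Proof. by move=> oU; apply: open_comp => // a _; exact: dr_inv_continuous. Qed.

Definition dr_setM A B : set G :=
  [set c | exists a b, [/\ A a, B b & dr_comp a b c]].

Lemma dr_setMA A B C : dr_setM (dr_setM A B) C = dr_setM A (dr_setM B C).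
Proof.
apply/seteqP; split=> [d [ab [c [[a [b [Aa Bb ab_]]] Cc d_]]]|].
  by have [bc bc_ d'] := dr_compA ab_ d_; exists a, bc; split=> //; exists b, c.
move=> d [a [bc [Aa [b [c [Bb Cc /dr_comp_inv bc_]]] /dr_comp_inv d_]]].
have [e /dr_comp_inv e1 /dr_comp_inv e2] := dr_compA bc_ d_.
rewrite !dr_invK in e1 e2; exists (dr_inv e), c; split=> //.
by exists a, b.
Qed.

Let dr_setM_nbhs_subproof i j a b c : dr_Zindex i -> dr_Zindex j ->
  dr_Zset i a -> dr_Zset j b -> dr_comp a b c ->
  (i.1.2 <= j.1.1.2)%N -> nbhs c (dr_setM (dr_Zset i) (dr_Zset j)).
Proof.
move: i j => [[[X m] n] Y] [[[X' p] q] Y'] /=.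
move=> [[oX oY] Xm Yn _ _] [[oX' oY'] Xp Yq _ _].
move=> [Xa Ya da ea] [Xb Yb db eb] /dr_compE[ab rc dc sc] np.
have pE : p = (n + (p - n))%N by lia.
have nearX : nbhs (dr_rng c)
    (X `&` (dr_iter m @^-1` (dr_iter n @` (Y `&` X')))).
  rewrite rc; apply: filterI; first exact: open_nbhs_nbhs.
  apply: (dr_iter_continuous (Xm _ Xa)); rewrite ea.
  apply: dr_iter_open; first exact: Yn.
  by apply: open_nbhs_nbhs; split; [exact: openI|split=> //; rewrite ab].
have nearY : nbhs (dr_src c) Y' by rewrite sc; exact: open_nbhs_nbhs.
have ec : dr_iter (m + (p - n)) (dr_rng c) = dr_iter q (dr_src c).
  by rewrite rc sc dr_iter_add ea ab -dr_iter_add -pE.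
have [|||U [V [UV Zc UX VY']]] := dr_Zset_around _ _ _ ec nearX nearY.
- by rewrite dc da db; lia.
- rewrite rc; apply/dr_domn_add; split; first exact: Xm.
  by rewrite ea ab; move: (Xp _ Xb); rewrite {1}pE => /dr_domn_add[].
- by rewrite sc; exact: Yq.
apply: filterS (dr_Zset_nbhs UV Zc) => c' [Uc' Vc' dc' ec'].
have [Xc' [y [Yy X'y] yc']] := UX _ Uc'.
have [a' a'E] : exists a', dr_val a' = (dr_rng c', m%:Z - n%:Z, y).
  apply: dr_arrowK; exists m, n; split=> //=; [exact: Xm|exact: Yn].
have ey : dr_iter p y = dr_iter q (dr_src c').
  by rewrite pE dr_iter_add yc' -dr_iter_add.
have [b' b'E] : exists b', dr_val b' = (y, p%:Z - q%:Z, dr_src c').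
  by apply: dr_arrowK; exists p, q; split=> //=; [exact: Xp|exact/Yq/VY'].
have E : (dr_rng a' = dr_rng c') * (dr_deg a' = m%:Z - n%:Z) * (dr_src a' = y).
  by rewrite /dr_rng /dr_deg /dr_src a'E.
have E' : (dr_rng b' = y) * (dr_deg b' = p%:Z - q%:Z) *
          (dr_src b' = dr_src c').
  by rewrite /dr_rng /dr_deg /dr_src b'E.
exists a', b'; split.
- by split; rewrite ?E.
- by split; rewrite ?E' //; exact: VY'.
- by apply/dr_compE; split; rewrite ?E ?E' // dc'; lia.
Qed.

Lemma dr_setM_open A B : open A -> open B -> open (dr_setM A B).
Proof.
move=> oA oB; rewrite openE => c [a [b [Aa Bb abc]]].
have [i [Di Zi iA]] := dr_nbhsP (open_nbhs_nbhs (conj oA Aa)).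
have [j [Dj Zj jB]] := dr_nbhsP (open_nbhs_nbhs (conj oB Bb)).
have [le_ij|/ltnW le_ji] := leqP i.1.2 j.1.1.2.
  apply: filterS (dr_setM_nbhs_subproof Di Dj Zi Zj abc le_ij) => c'.
  by move=> [a' [b' [/iA ? /jB ? ?]]]; exists a', b'.
move: i j Di Dj Zi Zj iA jB le_ji => [[[X m] n] Y] [[[X' p] q] Y'] /=.
move=> Di Dj Zi Zj iA jB le_ji.
rewrite -[a]dr_invK in Zi; rewrite -[b]dr_invK in Zj.
move/dr_Zset_inv in Zi; move/dr_Zset_inv in Zj.
have := dr_setM_nbhs_subproof (dr_Zindex_inv Dj) (dr_Zindex_inv Di) Zj Zi
  (dr_comp_inv abc) le_ji.
move=> /dr_inv_continuous H.
apply: filterS (H : nbhs c (dr_inv @^-1` _)) => c' /=.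
move=> [b' [a' [/dr_Zset_inv Zb' /dr_Zset_inv Za' /dr_comp_inv]]].
rewrite dr_invK => c'E; exists (dr_inv a'), (dr_inv b').
by split; [exact: iA|exact: jB|].
Qed.

Definition dr_bisection U : Prop :=
  {in U &, injective (@dr_rng S)} /\ {in U &, injective (@dr_src S)}.

(** Compact open bisections. *)
Definition dr_cob U : Prop := [/\ compact U, open U & dr_bisection U].

Lemma dr_bisectionM A B :
  dr_bisection A -> dr_bisection B -> dr_bisection (dr_setM A B).
Proof.
move=> [rA sA] [rB sB]; split=> c c' /[!inE] -[a [b [Aa Bb abc]]]
  [a' [b' [Aa' Bb' abc']]] cc';
  have [h1 h2 h3 h4] := (iffLR (dr_compE _ _ _) abc);
  have [k1 k2 k3 k4] := (iffLR (dr_compE _ _ _) abc').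
- have aa' : a = a' by apply: rA; rewrite ?inE// -h2 cc'.
  have bb' : b = b' by apply: rB; rewrite ?inE// -h1 aa'.
  by move: abc'; rewrite -aa' -bb'; exact: dr_comp_uniq.
- have bb' : b = b' by apply: sB; rewrite ?inE// -h4 cc'.
  have aa' : a = a' by apply: sA; rewrite ?inE// h1 bb'.
  by move: abc'; rewrite -aa' -bb'; exact: dr_comp_uniq.
Qed.

Lemma dr_compactM U V : dr_cob U -> dr_cob V -> compact (dr_setM U V).
Proof.
move=> [cU oU bU] [cV oV bV].
have crV : compact (@dr_rng S @` V).
  by apply: continuous_compact => //; apply: continuous_subspaceT;
     exact: dr_rng_continuous.
pose U' := U `&` (@dr_src S @^-1` (@dr_rng S @` V)).
have cU' : compact U'.
  apply: compact_closedI => //; apply: preimage_closed.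
    by move=> a _; exact: dr_src_continuous.
  by apply: compact_closed => //; exact: dr_hausdorff.
pose phi a := xget a [set c | exists2 b, V b & dr_comp a b c].
have phiE a b c : V b -> dr_comp a b c -> phi a = c.
  move=> Vb abc; rewrite /phi; case: xgetP => [c' _ [b' Vb' abc']|/(_ c)[]].
    suff bb' : b = b' by move: abc'; rewrite -bb' => /dr_comp_uniq; exact.
    by apply: bV.1; rewrite ?inE//; case: abc => <- _; case: abc' => <-.
  by exists b.
have -> : dr_setM U V = phi @` U'.
  apply/seteqP; split=> [c [a [b [Ua Vb abc]]]|_ [a [Ua [b Vb ab]] <-]].
    exists a; last exact: phiE abc.
    by split=> //; exists b => //; case: abc.
  have [c abc] := dr_comp_ex (esym ab).
  by rewrite (phiE _ _ _ Vb abc); exists a, b.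
apply: continuous_compact => //; apply/subspace_continuousP.
move=> a [Ua [b Vb ab]] W Wa.
have [c abc] := dr_comp_ex (esym ab).
have cW : nbhs c W by rewrite -(phiE _ _ _ Vb abc).
have [W' [oW' W'c] W'W] : exists2 B, open_nbhs c B & B `<=` W.
  by move: cW; rewrite nbhsE.
have aWV : nbhs a (dr_setM W' (dr_inv @^-1` V)).
  apply: open_nbhs_nbhs; split.
    by apply: dr_setM_open => //; exact: dr_inv_open.
  by exists c, (dr_inv b); split; rewrite /= ?dr_invK//; exact: dr_comp_divr.
change (nbhs a [set a' | U' a' -> W (phi a')]).
apply: filterS aWV => a' [w [v [W'w Vv wva']]] [Ua' _].
by apply: W'W; rewrite (phiE _ _ _ Vv (dr_comp_divr wva')).
Qed.

Lemma dr_cobM U V : dr_cob U -> dr_cob V -> dr_cob (dr_setM U V).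
Proof.
move=> cU cV; have [[_ oU bU] [_ oV bV]] := (cU, cV); split.
- exact: dr_compactM.
- exact: dr_setM_open.
- exact: dr_bisectionM.
Qed.

End GroupoidTheory.

(** Associative rings that need not have a unit. *)
HB.mixin Record Zmodule_isRng R & GRing.Zmodule R := {
  rmul : R -> R -> R;
  rmulA : associative rmul;
  rmulDl : left_distributive rmul +%R;
  rmulDr : right_distributive rmul +%R }.

#[short(type="rngType")]
HB.structure Definition Rng := {R of GRing.Zmodule R & Zmodule_isRng R}.

HB.mixin Record Zmodule_isRngModule (R : rngType) M & GRing.Zmodule M := {
  ract : R -> M -> M;
  ractA : forall r s x, ract r (ract s x) = ract (rmul r s) x;
  ractDl : forall x, {morph ract^~ x : r s / r + s};
  ractDr : forall r, {morph ract r : x y / x + y} }.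

#[short(type="rngModType")]
HB.structure Definition RngModule (R : rngType) :=
  {M of GRing.Zmodule M & Zmodule_isRngModule R M}.

Section Modules.
Variable R : rngType.

Definition submodule (M : rngModType R) (N : set M) : Prop :=
  [/\ N 0, forall x y, N x -> N y -> N (x - y)
    & forall (r : R) x, N x -> N (ract r x)].

Definition noetherian (M : rngModType R) : Prop :=
  forall N : nat -> set M, (forall n, submodule (N n)) ->
    (forall n, N n `<=` N n.+1) ->
    exists n, forall m, (n <= m)%N -> N m = N n.

(** [RM = M], where [RM] consists of the finite sums of elements [rx]. *)
Definition unital (M : rngModType R) : Prop :=
  forall x : M, exists s : seq (R * M), x = \sum_(p <- s) ract p.1 p.2.

(** [M] is the smallest submodule containing some finite family. *)
Definition finitely_generated (M : rngModType R) : Prop :=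
  exists s : seq M, forall N : set M, submodule N ->
    (forall x, x \in s -> N x) -> N = [set: M].

Definition regular_module : Type := R.
HB.instance Definition _ := GRing.Zmodule.on regular_module.
HB.instance Definition _ := Zmodule_isRngModule.Build R regular_module
  rmulA (fun x r s => rmulDl r s x) (fun r x y => rmulDr r x y).

End Modules.

Definition left_noetherian (R : rngType) : Prop :=
  noetherian (regular_module R).

Section Corner.
Variable R : rngType.
Implicit Types e x y : R.

Lemma rmulBr x y z : rmul x (y - z) = rmul x y - rmul x z :> R.
Proof. by apply/(addIr (rmul x z)); rewrite subrK -rmulDr subrK. Qed.

Lemma rmulBl x y z : rmul (y - z) x = rmul y x - rmul z x :> R.
Proof. by apply/(addIr (rmul z x)); rewrite subrK -rmulDl subrK. Qed.

Lemma rmulr0 x : rmul x 0 = 0 :> R.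
Proof. by rewrite -[0 in LHS](subrr 0) rmulBr subrr. Qed.

Lemma rmul0r x : rmul 0 x = 0 :> R.
Proof. by rewrite -[0 in LHS](subrr 0) rmulBl subrr. Qed.

Definition corner_set e : set R := [set x | exists y, x = rmul (rmul e y) e].
Definition corner_pred e : {pred R} := [pred x | `[< corner_set e x >]].

Lemma corner_pred_zmod_closed e : zmod_closed (corner_pred e).
Proof.
split=> [|x y /asboolP[x' ->] /asboolP[y' ->]]; apply/asboolP.
  by exists 0; rewrite rmulr0 rmul0r.
by exists (x' - y'); rewrite rmulBr rmulBl.
Qed.

HB.instance Definition _ e :=
  GRing.isZmodClosed.Build R (corner_pred e) (corner_pred_zmod_closed e).

Record corner e := Corner {
  corner_val :> R;
  corner_valP : corner_val \in corner_pred e }.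

HB.instance Definition _ e := [isSub for @corner_val e].
HB.instance Definition _ e := [Choice of corner e by <:].
HB.instance Definition _ e := [SubChoice_isSubZmodule of corner e by <:].

Lemma corner_mul_subproof e (x y : corner e) :
  rmul (corner_val x) (corner_val y) \in corner_pred e.
Proof.
have /asboolP[x' ->] := corner_valP x; have /asboolP[y' ->] := corner_valP y.
apply/asboolP; exists (rmul x' (rmul e (rmul e y'))).
by rewrite !rmulA.
Qed.

Definition corner_mul e (x y : corner e) : corner e :=
  Corner (corner_mul_subproof x y).

Lemma corner_mulA e : associative (@corner_mul e).
Proof. by move=> x y z; apply: val_inj; exact: rmulA. Qed.

Lemma corner_mulDl e : left_distributive (@corner_mul e) +%R.
Proof. by move=> x y z; apply: val_inj; exact: rmulDl. Qed.

Lemma corner_mulDr e : right_distributive (@corner_mul e) +%R.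
Proof. by move=> x y z; apply: val_inj; exact: rmulDr. Qed.

HB.instance Definition _ e := Zmodule_isRng.Build (corner e)
  (@corner_mulA e) (@corner_mulDl e) (@corner_mulDr e).

End Corner.

Definition categorically_noetherian (R : rngType) : Prop :=
  forall M : rngModType R, unital M -> finitely_generated M -> noetherian M.

Definition locally_noetherian (R : rngType) : Prop :=
  forall s : seq R, exists e : R,
    [/\ rmul e e = e, forall x, x \in s -> corner_set e x
      & left_noetherian (corner e)].

Section Steinberg.
Variables (K : fieldType) (S : drSystem).
Local Notation G := (drGroupoid S).
Implicit Types (f g h : G -> K) (a b c : G) (U V : set G).

(** The sum has finite support when [f] is in [steinberg_set]; see
    [dr_conv_indic] for [1_U * 1_V = 1_UV]. *)
Definition dr_conv f g : G -> K := fun c =>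
  \sum_(p \in [set p : G * G | dr_comp p.1 p.2 c]) f p.1 * g p.2.

(** The linear span of the indicators of compact open bisections. *)
Definition steinberg_set : set (G -> K) :=
  [set f | exists s : seq (K * set G), (forall p, p \in s -> dr_cob p.2) /\
     forall a, f a = \sum_(p <- s) p.1 * \1_(p.2) a].

Lemma steinberg_ind (P : (G -> K) -> Prop) : P 0 ->
  (forall k U f, dr_cob U -> steinberg_set f -> P f ->
     P (fun a => k * \1_U a + f a)) ->
  forall f, steinberg_set f -> P f.
Proof.
move=> P0 Pind f [s [scob fE]]; have {fE} -> : f =
  (fun a => \sum_(p <- s) p.1 * \1_(p.2) a) by exact/funext.
elim: s scob => [|[k U] s IHs] scob.
  by rewrite (_ : (fun _ => _) = 0)//; apply/funext => a; rewrite big_nil.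
rewrite (_ : (fun _ => _) =
    (fun a => k * \1_U a + \sum_(p <- s) p.1 * \1_(p.2) a)).
  have scob' p : p \in s -> dr_cob p.2.
    by move=> ps; apply: scob; rewrite in_cons ps orbT.
  apply: Pind; last exact: IHs.
    by apply: (scob (k, U)); rewrite mem_head.
  by exists s.
by apply/funext => a; rewrite big_cons.
Qed.

Lemma steinberg_set0 : steinberg_set 0.
Proof. by exists [::]; split=> // a; rewrite big_nil. Qed.

Lemma steinberg_setZD k f g : steinberg_set f -> steinberg_set g ->
  steinberg_set (fun a => k * f a + g a).
Proof.
move=> [s [scob fE]] [t [tcob gE]].
exists ([seq (k * p.1, p.2) | p <- s] ++ t); split.
  by move=> p; rewrite mem_cat => /orP[/mapP[q /scob ? ->]|/tcob].
move=> a; rewrite fE gE big_cat big_map mulr_sumr; congr (_ + _).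
by apply: eq_bigr => p _; rewrite mulrA.
Qed.

Lemma steinberg_indic U : dr_cob U -> steinberg_set \1_U.
Proof.
move=> cU; exists [:: (1, U)]; split; first by move=> p /[!inE] /eqP ->.
by move=> a; rewrite big_seq1 mul1r.
Qed.

Lemma steinberg_fiber_finite f c : steinberg_set f ->
  finite_set [set a | dr_rng a = dr_rng c /\ f a != 0].
Proof.
move: f; apply: steinberg_ind => [|k U f [_ _ [rU _]] _ fin].
  by rewrite (_ : mkset _ = set0)// -subset0 => a [_ /eqP].
have finU : finite_set [set a | dr_rng a = dr_rng c /\ U a].
  have [[a0 [ra0 Ua0]]|U0] := pselect (exists a, dr_rng a = dr_rng c /\ U a).
    apply: (@sub_finite_set _ _ [set a0]) => [a [ra Ua]|]; last first.
      exact: finite_set1.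
    by apply: rU; rewrite ?inE// ra.
  rewrite (_ : mkset _ = set0)// -subset0 => a Ua.
  by apply: U0; exists a.
apply: sub_finite_set (_ : finite_set ([set a | dr_rng a = dr_rng c /\ U a] `|`
    [set a | dr_rng a = dr_rng c /\ f a != 0])); last by rewrite finite_setU.
move=> a [ra]; have [Ua _|Ua] := pselect (U a); first by left.
by rewrite indicE memNset// mulr0 add0r; right.
Qed.

Let supp f c : set (G * G) := [set p | dr_comp p.1 p.2 c /\ f p.1 != 0].

Let supp_finite f c : steinberg_set f -> finite_set (supp f c).
Proof.
move=> /(@steinberg_fiber_finite _ c) fin.
apply: sub_finite_set (finite_image (fun a => (a,
  xget a [set b | dr_comp a b c])) fin) => -[a b] [/= abc fa].
exists a.
  by split=> //; have /dr_compE[_ ->] := abc.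
by congr pair; case: xgetP => [b' _ /(dr_comp_uniqr abc) //|/(_ b)[]].
Qed.

Let dr_conv_supp f g c (D : set (G * G)) : supp f c `<=` D ->
  D `<=` [set p | dr_comp p.1 p.2 c] ->
  dr_conv f g c = \sum_(p \in D) f p.1 * g p.2.
Proof.
move=> fD Dc; apply/esym; apply: fsbig_widen => // p [pc pD] /=.
have [->|fp] := eqVneq (f p.1) 0; first by rewrite mul0r.
by case: pD; apply: fD.
Qed.

Lemma dr_convZDl k f f' g : steinberg_set f -> steinberg_set f' ->
  dr_conv (fun a => k * f a + f' a) g =
  (fun a => k * dr_conv f g a + dr_conv f' g a).
Proof.
move=> fS f'S; apply/funext => c.
have Dfin : finite_set (supp f c `|` supp f' c).
  by rewrite finite_setU; split; exact: supp_finite.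
have Dc : supp f c `|` supp f' c `<=` [set p | dr_comp p.1 p.2 c].
  by move=> p [[]|[]].
rewrite (dr_conv_supp _ _ Dc); last first.
  move=> p [pc fp]; have [f0|] := eqVneq (f p.1) 0; last by left.
  by right; split=> //; move: fp; rewrite f0 mulr0 add0r.
rewrite (dr_conv_supp g (@subsetUl _ _ _) Dc).
rewrite (dr_conv_supp g (@subsetUr _ _ _) Dc).
rewrite mulr_fsumr -fsbig_split//; apply: eq_fsbigr => p _.
by rewrite mulrDl mulrA.
Qed.

Lemma dr_convZDr k f g g' : steinberg_set f ->
  dr_conv f (fun a => k * g a + g' a) =
  (fun a => k * dr_conv f g a + dr_conv f g' a).
Proof.
move=> fS; apply/funext => c.
have Dc : supp f c `<=` [set p | dr_comp p.1 p.2 c] by move=> p [].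
rewrite !(dr_conv_supp _ (@subset_refl _ _) Dc).
rewrite mulr_fsumr -fsbig_split//; last exact: supp_finite.
by apply: eq_fsbigr => p _; rewrite mulrDr mulrCA.
Qed.

Lemma dr_conv0l g : dr_conv 0 g = 0.
Proof. by apply/funext => c; apply: fsbig1 => p _; rewrite mul0r. Qed.

Lemma dr_conv0r f : dr_conv f 0 = 0.
Proof. by apply/funext => c; apply: fsbig1 => p _; rewrite mulr0. Qed.

Lemma dr_conv_indic U V : dr_cob U -> dr_cob V ->
  dr_conv \1_U \1_V = \1_(dr_setM U V).
Proof.
move=> [_ _ [rU _]] [_ _ _]; apply/funext => c; rewrite [RHS]indicE.
have [[a [b [Ua Vb abc]]]|UVc] := pselect (dr_setM U V c); last first.
  rewrite memNset//; apply: fsbig1 => -[a b] /= abc; rewrite !indicE.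
  have [Ua|Ua] := pselect (U a); last by rewrite memNset// mul0r.
  have [Vb|Vb] := pselect (V b); last by rewrite (memNset Vb) mulr0.
  by case: UVc; exists a, b.
rewrite mem_set; last by exists a, b.
rewrite (@dr_conv_supp _ _ _ [set (a, b)]).
- by rewrite fsbig_set1 !indicE !mem_set// mulr1.
- move=> [a' b'] [/= abc']; rewrite indicE.
  have [Ua'|Ua'] := pselect (U a'); last by rewrite memNset// eqxx.
  move=> _; have aa' : a' = a.
    apply: rU; rewrite ?inE//.
    by have /dr_compE[_ <- _ _] := abc'; have /dr_compE[_ <- _ _] := abc.
  by move: abc'; rewrite aa' => /(dr_comp_uniqr abc) ->.
- by move=> _ ->.
Qed.

Lemma steinberg_set_conv f g : steinberg_set f -> steinberg_set g ->
  steinberg_set (dr_conv f g).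
Proof.
move=> fS gS; move: f fS; apply: steinberg_ind.
  by rewrite dr_conv0l; exact: steinberg_set0.
move=> k U f cU fS fgS; rewrite dr_convZDl//; last exact: steinberg_indic.
apply: steinberg_setZD => //; move: g gS {fgS}; apply: steinberg_ind.
  by rewrite dr_conv0r; exact: steinberg_set0.
move=> l V g cV gS IH; rewrite dr_convZDr//; last exact: steinberg_indic.
apply: steinberg_setZD => //; rewrite dr_conv_indic//.
exact/steinberg_indic/dr_cobM.
Qed.

Lemma dr_convA f g h : steinberg_set f -> steinberg_set g -> steinberg_set h ->
  dr_conv f (dr_conv g h) = dr_conv (dr_conv f g) h.
Proof.
move=> fS gS hS; move: f fS; apply: steinberg_ind; first by rewrite !dr_conv0l.
move=> k U f cU fS IHf; have US := steinberg_indic cU.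
rewrite !dr_convZDl//; [|exact: steinberg_set_conv..].
rewrite IHf; apply/funext => x; congr (_ * _ x + _) => {k x f fS IHf}.
move: g gS; apply: steinberg_ind; first by rewrite !(dr_conv0l, dr_conv0r).
move=> k V g cV gS IHg; have VS := steinberg_indic cV.
rewrite dr_convZDl// !dr_convZDr// dr_convZDl//; [|exact: steinberg_set_conv..].
rewrite IHg; apply/funext => x; congr (_ * _ x + _) => {k x g gS IHg}.
move: h hS; apply: steinberg_ind; first by rewrite !dr_conv0r.
move=> k W h cW hS IHh; have WS := steinberg_indic cW.
rewrite !dr_convZDr//; last exact: steinberg_set_conv.
rewrite IHh; apply/funext => x; congr (_ * _ x + _).
by rewrite !dr_conv_indic ?dr_setMA//; exact: dr_cobM.
Qed.

Definition steinberg_pred : {pred G -> K} := [pred f | `[< steinberg_set f >]].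

Lemma steinberg_pred_zmod_closed : zmod_closed steinberg_pred.
Proof.
split=> [|f g /asboolP fS /asboolP gS]; apply/asboolP.
  exact: steinberg_set0.
rewrite (_ : f - g = (fun a => -1 * g a + f a)); first exact: steinberg_setZD.
by apply/funext => a; rewrite mulN1r addrC.
Qed.

HB.instance Definition _ :=
  GRing.isZmodClosed.Build (G -> K) steinberg_pred steinberg_pred_zmod_closed.

Record steinberg := Steinberg {
  steinberg_val :> G -> K;
  steinberg_valP : steinberg_val \in steinberg_pred }.

HB.instance Definition _ := [isSub for steinberg_val].
HB.instance Definition _ := [Choice of steinberg by <:].
HB.instance Definition _ := [SubChoice_isSubZmodule of steinberg by <:].

Lemma steinberg_mul_subproof (f g : steinberg) :
  dr_conv f g \in steinberg_pred.
Proof.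
have /asboolP fS := steinberg_valP f; have /asboolP gS := steinberg_valP g.
exact/asboolP/steinberg_set_conv.
Qed.

Definition steinberg_mul (f g : steinberg) : steinberg :=
  Steinberg (steinberg_mul_subproof f g).

Lemma steinberg_mulA : associative steinberg_mul.
Proof.
move=> f g h; apply: val_inj; apply: dr_convA; exact/asboolP/steinberg_valP.
Qed.

Lemma steinberg_mulDl : left_distributive steinberg_mul +%R.
Proof.
move=> f g h; apply: val_inj => /=.
have /asboolP fS := steinberg_valP f; have /asboolP gS := steinberg_valP g.
rewrite (_ : val f + val g = (fun a => 1 * f a + g a)).
  by rewrite dr_convZDl//; apply/funext => a; rewrite mul1r.
by apply/funext => a; rewrite mul1r.
Qed.

Lemma steinberg_mulDr : right_distributive steinberg_mul +%R.
Proof.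
move=> f g h; apply: val_inj => /=; have /asboolP fS := steinberg_valP f.
rewrite (_ : val g + val h = (fun a => 1 * g a + h a)).
  by rewrite dr_convZDr//; apply/funext => a; rewrite mul1r.
by apply/funext => a; rewrite mul1r.
Qed.

HB.instance Definition _ := Zmodule_isRng.Build steinberg
  steinberg_mulA steinberg_mulDl steinberg_mulDr.

End Steinberg.

(* Main.v *)
Require Import Defs.
From HB Require Import structures.
From mathcomp Require Import all_boot all_order all_algebra.
From mathcomp Require Import boolp classical_sets functions.
From mathcomp Require Import cardinality fsbigop topology numfun.
From mathcomp Require Import zify.

Set Implicit Arguments.
Unset Strict Implicit.
Unset Printing Implicit Defensive.

Import Order.TTheory GRing.Theory Num.Theory.

Local Open Scope classical_set_scope.
Local Open Scope ring_scope.

(** The four properties are proved equivalent in a circle.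

    If [X] is discrete, then singletons are admissible in the basic sets
    [Z(U, m, n, V)], which shrink to points, so the groupoid [G] is discrete
    ([discrete_groupoid]).

    If [G] is discrete, its Steinberg algebra [A] is spanned by point masses
    [1_a], and a finitely generated unital module is a quotient of a finite sum
    of modules [A e_x] with [e_x] the indicator of a unit.  A submodule [N] of
    [A e_x] is determined by [e_x N], because left multiplication by [1_a]
    moves [e_x N] isomorphically onto [e_y N] for every arrow [a] from [x] to
    [y].  Now [e_x A e_x] is the group algebra of the isotropy group at [x],
    which is a subgroup of the integers, hence cyclic; up to multiplication by
    a power of its generator every element of it is a polynomial in that
    generator.  So chains of submodules of [A e_x] stabilise because chains of
    ideals of [K[X]] do ([noetherian_below_unit],
    [discrete_categorically_noetherian]).

    The algebra [A] of any [G] has local units: the indicators of compact open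
    sets of units ([steinberg_local_unit]).  If [e] is an idempotent, the module
    [Re] is unital and generated by [e]; when it is Noetherian, so is the ring
    [eRe], because a left ideal [J] of [eRe] is recovered from the submodule
    [{x | e R x <= J}] of [Re] ([noetherian_corner]).

    Finally, suppose that [X] has a point [x] which is not open.  As [X] is
    locally compact, Hausdorff and totally disconnected, [x] has arbitrarily
    small compact open neighbourhoods ([compact_open_nbhs]), so there is a
    strictly decreasing sequence [V_n] of them.  In a corner [eAe] that contains
    the indicator of [V_0], the functions vanishing on all arrows with source in
    [V_n] form a left ideal; these ideals increase strictly, as the indicator
    of the set of units [V_n \ V_n+1] shows, so [eAe] is not Noetherian
    ([locally_noetherian_discrete]). *)

(** * Compact open neighbourhoods in totally disconnected spaces *)

Section Quasicomponent.
Variables (T : topologicalType) (K : set T) (x : T).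

Definition clopen_in_around : set (set T) :=
  [set D | [/\ D `<=` K, D x, closed D & closed (K `\` D)]].

Definition quasicomponent : set T := \bigcap_(D in clopen_in_around) D.

Hypotheses (Kclosed : closed K) (Kx : K x).

Lemma clopen_in_around_self : clopen_in_around K.
Proof. by split=> //; rewrite setDv; exact: closed0. Qed.

Lemma clopen_in_aroundI C D :
  clopen_in_around C -> clopen_in_around D -> clopen_in_around (C `&` D).
Proof.
move=> [CK Cx cC cC'] [DK Dx cD cD']; split=> //.
- by move=> y [/CK].
- exact: closedI.
- by rewrite setDIr; exact: closedU.
Qed.

Lemma quasicomponent_closed : closed quasicomponent.
Proof. by apply: closed_bigI => D []. Qed.

Lemma quasicomponent_self : quasicomponent x.
Proof. by move=> D []. Qed.

(** By compactness of [K]: the sets [D \ O], for [D] relatively clopen around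
    [x], are directed, so if none is empty they have a cluster point, which lies
    in every [D] and outside [O]. *)
Lemma quasicomponent_nbhs_clopen O : compact K -> open O ->
  quasicomponent `<=` O -> exists2 D, clopen_in_around D & D `<=` O.
Proof.
move=> Kcompact oO QO; apply: contrapT => noD.
pose F := filter_from clopen_in_around (fun D => D `\` O).
have FF : ProperFilter F.
  apply: filter_from_proper.
    apply: filter_from_filter; first by exists K; exact: clopen_in_around_self.
    move=> C D HC HD; exists (C `&` D); first exact: clopen_in_aroundI.
    by move=> y [[? ?] ?].
  move=> D HD; apply: contrapT => DO; apply: noD; exists D => // y Dy.
  by apply: contrapT => Oy; apply: DO; exists y.
have FK : F K.
  by exists K; [exact: clopen_in_around_self|move=> y []].
have [p [Kp Fp]] := Kcompact F FF FK.
have pD D : clopen_in_around D -> closure (D `\` O) p.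
  by move=> HD W Wp; apply: Fp => //; exists D.
suff Op : O p.
  have oOp : nbhs p O by exact: open_nbhs_nbhs.
  by have [y [[_ +] Oy]] := pD K clopen_in_around_self O oOp.
apply: QO => D HD; have [_ _ cD _] := HD.
by apply: cD; apply: closureS (pD D HD) => y [].
Qed.

(** If the quasicomponent split into disjoint closed sets [B], containing [x],
    and [B'], then by normality some open [U] contains [B] and has closure
    disjoint from [B'].  A relatively clopen [D] inside the union of [U] and the
    exterior of [U] meets [U] in a relatively clopen set around [x], which
    therefore contains the quasicomponent and forces [B'] to be empty.  The
    compact set [L] around [K] is where normality is available. *)
Lemma quasicomponent_connected (L : set T) : hausdorff_space T ->
  compact L -> K `<=` L° -> connected quasicomponent.
Proof.
move=> hT cL KL.
have QK : quasicomponent `<=` K.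
  by move=> y; apply; exact: clopen_in_around_self.
have cK : compact K.
  by apply: (subclosed_compact _ cL) => // y /KL /interior_subset.
have cQ := quasicomponent_closed.
have key (B : set T) : B x -> (exists2 C, open C & B = quasicomponent `&` C) ->
    (exists2 C, closed C & B = quasicomponent `&` C) -> B = quasicomponent.
  move=> Bx [C oC BC] [C' cC' BC'].
  have BQ : B `<=` quasicomponent by rewrite BC => y [].
  have cB : closed B by rewrite BC'; exact: closedI.
  have cB' : closed (quasicomponent `\` B).
    suff -> : quasicomponent `\` B = quasicomponent `&` ~` C.
      by apply: closedI => //; exact: open_closedC.
    rewrite BC; apply/seteqP; split=> [y [Qy nB]|y [Qy nC]]; split=> //.
      by move=> Cy; apply: nB.
    by move=> [].
  have BL : B `<=` L° by move=> y /BQ /QK /KL.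
  have nB : set_nbhs B (~` (quasicomponent `\` B)).
    apply/set_nbhsP; exists (~` (quasicomponent `\` B)); split=> //.
      exact: closed_openC.
    by move=> y By [].
  have [N /set_nbhsP[U [oU BU UN]] NB] := compact_normal_local hT cL BL cB nB.
  have [D [DK Dx cD cD'] DU] :
      exists2 D, clopen_in_around D & D `<=` U `|` ~` closure N.
    apply: quasicomponent_nbhs_clopen => //.
      by apply: openU => //; exact/closed_openC/closed_closure.
    move=> y Qy; have [By|nBy] := pselect (B y); first by left; exact: BU.
    by right => /NB; apply.
  have UclN : U `<=` closure N by move=> y /UN; exact: subset_closure.
  have : clopen_in_around (D `&` U).
    split.
    - by move=> y [/DK].
    - by split=> //; exact: BU.
    - suff -> : D `&` U = D `&` closure N.
        by apply: closedI => //; exact: closed_closure.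
      apply/seteqP; split=> y [Dy]; first by move/UclN.
      by have [] := DU _ Dy.
    - rewrite setDIr; suff -> : K `\` D `|` K `\` U = K `\` D `|` K `&` ~` U.
        by apply: closedU => //; apply: closedI => //; exact: open_closedC.
      by rewrite setDE.
  move=> HDU; apply/seteqP; split=> // y Qy; apply: contrapT => nBy.
  have [_ /UclN /NB] : (D `&` U) y by exact: Qy.
  by apply.
move=> B [b Bb] oB clB; have [Bx|nBx] := pselect (B x); first exact: key.
have QB : quasicomponent `\` B = quasicomponent.
  apply: key; first by split=> //; exact: quasicomponent_self.
  - have [C cC BC] := clB; exists (~` C); first exact: closed_openC.
    rewrite BC; apply/seteqP; split=> y [Qy h]; split=> //; last by move=> [].
    by move=> Cy; apply: h.
  - have [C oC BC] := oB; exists (~` C); first exact: open_closedC.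
    rewrite BC; apply/seteqP; split=> y [Qy h]; split=> //; last by move=> [].
    by move=> Cy; apply: h.
have : quasicomponent b by have [C _ BC] := oB; move: Bb; rewrite BC => -[].
by rewrite -QB => -[].
Qed.

End Quasicomponent.

(** In a compact neighbourhood [K] of [x] the quasicomponent of [x] is
    connected, hence reduced to [x], so a relatively clopen subset of [K] fits
    in the interior of [K]; such a set is open in the whole space. *)
Lemma compact_open_nbhs (T : topologicalType) (x : T) (W : set T) :
  locally_compact [set: T] -> hausdorff_space T ->
  totally_disconnected [set: T] -> nbhs x W ->
  exists C : set T, [/\ compact C, open C, C x & C `<=` W].
Proof.
move=> lcT hT tdT Wx.
have [L Lx [cL _]] : exists2 L, nbhs x L & compact L /\ closed L.
  have [L Lx cL] := lcT x I.
  exists L => //; apply: (filterS _ (Lx : nbhs x [set y | setT y -> L y])).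
  by move=> y; apply.
have Lx' : L° x by exact: Lx.
have [D Dx DWL] : exists2 D, nbhs x D & closure D `<=` W° `&` L°.
  have [] := @compact_regular T x L hT cL Lx (W° `&` L°).
    by apply: filterI; exact: nbhs_interior.
  by move=> D; exists D.
pose K := closure D.
have clK : closed K by exact: closed_closure.
have DK : D `<=` K by exact: subset_closure.
have Kx : K x by apply: DK; exact: nbhs_singleton.
have KL : K `<=` L° by move=> y /DWL[].
have cK : compact K.
  by apply: (subclosed_compact _ cL) => // y /KL /interior_subset.
have Q1 : quasicomponent K x `<=` [set x].
  rewrite -(tdT x I); apply: connected_component_max => //.
    exact: quasicomponent_self.
  exact: (quasicomponent_connected clK Kx hT cL KL).
have oD : open D° by exact: open_interior.
have [C [CK Cx cC cC'] CD] :
    exists2 C, clopen_in_around K x C & C `<=` D°.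
  by apply: quasicomponent_nbhs_clopen => // y /Q1 ->.
exists C; split=> //.
- exact: (subclosed_compact cC cK).
- suff -> : C = D° `&` ~` (K `\` C) by apply: openI => //; exact: closed_openC.
  apply/seteqP; split=> [y Cy|y [Dy nKC]].
    by split; [exact: CD|move=> []].
  apply: contrapT => nC; apply: nKC; split=> //; apply: DK.
  exact: interior_subset.
- by move=> y /CD /interior_subset /DK /DWL[/interior_subset].
Qed.

Lemma discrete_space_singletons (T : topologicalType) :
  (forall x : T, open [set x]) -> discrete_space T.
Proof.
move=> o1 A; rewrite openE => x Ax; rewrite /interior nbhsE.
by exists [set x] => [|_ ->]//; split.
Qed.

(** The cofinite subsets of an infinite compact set would have a cluster point,
    which is impossible as points are open. *)
Lemma discrete_compact_finite (T : topologicalType) (A : set T) :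
  discrete_space T -> compact A -> finite_set A.
Proof.
move=> dT cA; apply: contrapT => Ainf.
pose F : set_system T := [set B | finite_set (A `\` B)].
have FF : ProperFilter F.
  split; first by rewrite /F /= setD0.
  split; first by rewrite /F /= setDT.
  - by move=> B C FB FC; rewrite /F /= setDIr finite_setU.
  - by move=> B C BC; apply: sub_finite_set; exact: setDS.
have FA : F A by rewrite /F /= setDv.
have [p [Ap Fp]] := cA F FF FA.
have [||y [[_ +] yp]] := Fp (A `\` [set p]) [set p].
- by rewrite /F /= setDD; apply: sub_finite_set (finite_set1 p) => y [].
- exact: open_nbhs_nbhs.
- by [].
Qed.

(** * Noetherian modules over rings without unit *)

Lemma subrACA (V : zmodType) (x y z t : V) :
  (x - y) - (z - t) = (x - z) - (y - t).
Proof. by rewrite !opprD addrACA. Qed.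

Lemma chain_le (T : Type) (N : nat -> set T) : (forall n, N n `<=` N n.+1) ->
  forall m n, (m <= n)%N -> N m `<=` N n.
Proof.
move=> chain m n /subnKC <-; elim: (n - m)%N => [|k IHk].
  by rewrite addn0.
by rewrite addnS; exact: subset_trans IHk (chain _).
Qed.

Definition stabilises (T : Type) (N : nat -> set T) :=
  exists n, forall m, (n <= m)%N -> N m `<=` N n.

Section ModuleTheory.
Variables (R : rngType) (M : rngModType R).
Implicit Types (N L : set M) (r : R) (x y : M).

Lemma ractBl r s x : ract (r - s) x = ract r x - ract s x.
Proof. by apply: (addIr (ract s x)); rewrite subrK -ractDl subrK. Qed.

Lemma ractBr r x y : ract r (x - y) = ract r x - ract r y.
Proof. by apply: (addIr (ract r y)); rewrite subrK -ractDr subrK. Qed.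

Lemma ract0l x : ract (0 : R) x = 0.
Proof. by rewrite -[0 in LHS](subrr 0) ractBl subrr. Qed.

Lemma ract0r r : ract r 0 = 0 :> M.
Proof. by rewrite -[0 in LHS](subrr 0) ractBr subrr. Qed.

Lemma ract_suml I (s : seq I) (F : I -> R) x :
  ract (\sum_(i <- s) F i) x = \sum_(i <- s) ract (F i) x.
Proof. exact: (big_morph (ract^~ x) (ractDl x) (ract0l x)). Qed.

Lemma ract_sumr I (s : seq I) (F : I -> M) r :
  ract r (\sum_(i <- s) F i) = \sum_(i <- s) ract r (F i).
Proof. exact: (big_morph (ract r) (ractDr r) (ract0r r)). Qed.

Lemma submoduleN N x : submodule N -> N x -> N (- x).
Proof. by move=> [N0 NB _] Nx; rewrite -[- x]add0r; exact: NB. Qed.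

Lemma submoduleD N x y : submodule N -> N x -> N y -> N (x + y).
Proof.
by move=> sN Nx Ny; rewrite -[y]opprK; case: (sN) => _ + _; apply=> //;
   exact: submoduleN.
Qed.

Lemma submodule_sum N (I : eqType) (s : seq I) (F : I -> M) : submodule N ->
  (forall i, i \in s -> N (F i)) -> N (\sum_(i <- s) F i).
Proof.
move=> sN NF; rewrite big_seq; elim/big_ind: _ => //; first by case: sN.
by move=> x y; exact: submoduleD.
Qed.

(** For an idempotent [e] this says that the left module [Re] is Noetherian: the
    condition [a e = a] means that [a] lies in [Re]. *)
Definition noetherian_below (e : R) := forall J : nat -> set (regular_module R),
  (forall n, submodule (J n)) -> (forall n, J n `<=` J n.+1) ->
  (forall n a, J n a -> rmul a e = a) -> stabilises J.

(** The sum of the cyclic modules [Rv], over the second components [v]; it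
    contains [v] when the first component [e] satisfies [e v = v]. *)
Fixpoint lspan (s : seq (R * M)) : set M :=
  if s is p :: s' then [set x | exists r, lspan s' (x - ract r p.2)]
  else [set 0].

Lemma lspan_submodule s : submodule (lspan s).
Proof.
elim: s => [|p s [L0 LB LM]] /=.
  by split=> //= [x y -> ->|r x ->]; rewrite ?subrr ?ract0r.
split.
- by exists 0; rewrite ract0l subr0.
- move=> x y [r Lr] [t Lt]; exists (r - t).
  by rewrite ractBl subrACA; exact: LB.
- by move=> r x [t Lt]; exists (rmul r t); rewrite -ractA -ractBr; exact: LM.
Qed.

Lemma lspan_gen s p : p \in s -> ract p.1 p.2 = p.2 -> lspan s p.2.
Proof.
elim: s => // q s IHs; rewrite inE => /orP[/eqP <-|/IHs ps] pE /=.
  by exists p.1; rewrite pE subrr; case: (lspan_submodule s).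
by exists 0; rewrite ract0l subr0; exact: ps.
Qed.

(** Extensions of Noetherian modules are Noetherian: in the step from [L] to
    [L + Rv], a chain [N] is controlled by its traces on [L] and by the left
    ideals of the [a] in [Re] with [a v] in [N + L]. *)
Lemma noetherian_lspan s (N : nat -> set M) :
  (forall p, p \in s ->
     [/\ rmul p.1 p.1 = p.1, ract p.1 p.2 = p.2 & noetherian_below p.1]) ->
  (forall n, submodule (N n)) -> (forall n, N n `<=` N n.+1) ->
  stabilises (fun n => N n `&` lspan s).
Proof.
move=> + sN Nchain; elim: s => [|[e v] s IHs] sP.
  by exists 0%N => m _ x /= [_ ->]; split=> //; case: (sN 0%N).
have [n1 Hn1] := IHs (fun p ps => sP p (mem_behead (s := (e, v) :: s) ps)).
have [/= ee ev eN] := sP (e, v) (mem_head _ _).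
have [L0 LB LM] := lspan_submodule s.
pose J n : set (regular_module R) :=
  [set a | rmul a e = a /\ exists2 l, lspan s l & N n (ract (a : R) v - l)].
have sJ n : submodule (J n).
  have [N0 NB NM] := sN n; split.
  - by split; [rewrite rmul0r|exists 0; rewrite // ract0l subr0].
  - move=> a b [ae [l Ll Nl]] [be [l' Ll' Nl']]; split.
      by rewrite rmulBl ae be.
    exists (l - l'); first exact: LB.
    by rewrite ractBl subrACA; exact: NB.
  - move=> r a [ae [l Ll Nl]]; split; first by rewrite -rmulA ae.
    exists (ract r l); first exact: LM.
    by rewrite -ractA -ractBr; exact: NM.
have Jchain n : J n `<=` J n.+1.
  by move=> a [ae [l Ll /Nchain Nl]]; split=> //; exists l.
have [n2 Hn2] := eN J sJ Jchain (fun n a => @proj1 _ _).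
exists (maxn n1 n2) => m; rewrite geq_max => /andP[n1m n2m] x [Nx [r Lr]].
have le1 := chain_le Nchain (leq_maxl n1 n2).
have le2 := chain_le Nchain (leq_maxr n1 n2).
split; last by exists r.
have rv : ract (rmul r e) v = ract r v by rewrite -ractA ev.
have [_ [l Ll Nl]] : J n2 (rmul r e).
  apply: (Hn2 m) => //; split; first by rewrite -rmulA ee.
  exists (- (x - ract r v)); first exact: submoduleN (lspan_submodule s) _.
  by rewrite rv opprK addrC subrK.
rewrite rv in Nl; have sN' := sN (maxn n1 n2).
rewrite -[x](subrK (ract r v - l)); apply: submoduleD => //; last exact: le2.
apply: le1; apply: (Hn1 m n1m _ _).1; split.
  by case: (sN m) => _ + _; apply=> //; exact: (chain_le Nchain n2m).
by rewrite opprB addrCA addrC; apply: submoduleD => //; exact: lspan_submodule.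
Qed.

(** The cyclic module [Rv] is a quotient of [Re] when [e v = v]. *)
Lemma noetherian_of_generators (s : seq (R * M)) :
  (forall p, p \in s ->
     [/\ rmul p.1 p.1 = p.1, ract p.1 p.2 = p.2 & noetherian_below p.1]) ->
  (forall N, submodule N -> (forall p, p \in s -> N p.2) -> N = [set: M]) ->
  noetherian M.
Proof.
move=> sP sgen N sN Nchain.
have LT : lspan s = [set: M].
  apply: sgen; first exact: lspan_submodule.
  by move=> p ps; apply: lspan_gen => //; have [] := sP p ps.
have [n Hn] := noetherian_lspan sP sN Nchain.
exists n => m nm; apply/seteqP; split; last exact: chain_le.
by move=> x Nx; apply: (Hn m nm x _).1; rewrite LT.
Qed.

End ModuleTheory.

Section PrincipalLeftIdeal.
Variables (R : rngType) (e : R).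

Definition left_ideal_pred : {pred R} := [pred x | rmul x e == x].

Lemma left_ideal_pred_zmod_closed : zmod_closed left_ideal_pred.
Proof.
split=> [|x y /eqP xe /eqP ye]; rewrite inE; first by rewrite rmul0r.
by rewrite rmulBl xe ye.
Qed.

HB.instance Definition _ :=
  GRing.isZmodClosed.Build R left_ideal_pred left_ideal_pred_zmod_closed.

(** The module [Re], as the set of fixed points of right multiplication by the
    idempotent [e]. *)
Record left_ideal := LeftIdeal {
  left_ideal_val :> R;
  left_ideal_valP : left_ideal_val \in left_ideal_pred }.

HB.instance Definition _ := [isSub for left_ideal_val].
HB.instance Definition _ := [Choice of left_ideal by <:].
HB.instance Definition _ := [SubChoice_isSubZmodule of left_ideal by <:].

Lemma left_ideal_act_subproof (r : R) (x : left_ideal) :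
  rmul r (left_ideal_val x) \in left_ideal_pred.
Proof. by have /eqP xe := left_ideal_valP x; rewrite inE -rmulA xe. Qed.

Definition left_ideal_act r x := LeftIdeal (left_ideal_act_subproof r x).

Lemma left_ideal_actA r s x :
  left_ideal_act r (left_ideal_act s x) = left_ideal_act (rmul r s) x.
Proof. by apply: val_inj; exact: rmulA. Qed.

Lemma left_ideal_actDl x : {morph left_ideal_act^~ x : r s / r + s}.
Proof. by move=> r s; apply: val_inj; exact: rmulDl. Qed.

Lemma left_ideal_actDr r : {morph left_ideal_act r : x y / x + y}.
Proof. by move=> x y; apply: val_inj; exact: rmulDr. Qed.

HB.instance Definition _ := Zmodule_isRngModule.Build R left_ideal
  left_ideal_actA left_ideal_actDl left_ideal_actDr.

Hypothesis eI : rmul e e = e.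

Lemma left_ideal_gen_subproof : e \in left_ideal_pred.
Proof. by rewrite inE eI. Qed.

Definition left_ideal_gen := LeftIdeal left_ideal_gen_subproof.

Lemma left_ideal_genE (x : left_ideal) :
  ract (left_ideal_val x) left_ideal_gen = x.
Proof. by apply: val_inj; apply/eqP; exact: left_ideal_valP. Qed.

Lemma corner_set_unit x : corner_set e x -> rmul e x = x /\ rmul x e = x.
Proof. by move=> [y ->]; split; [rewrite !rmulA eI|rewrite -rmulA eI]. Qed.

Lemma corner_setP x : rmul e x = x -> rmul x e = x -> corner_set e x.
Proof. by move=> ex xe; exists x; rewrite ex xe. Qed.

(** The module [Re] is generated by [e], so it is Noetherian.  A left ideal [J]
    of [eRe] gives the submodule [{x | e R x <= J}] of [Re], and is its trace on
    [eRe]: for [x] in [eRe], the set [e R x = (eRe) x] is contained in [J] if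
    and only if [x] belongs to [J]. *)
Lemma noetherian_corner :
  categorically_noetherian R -> left_noetherian (corner e).
Proof.
move=> catN.
have noethRe : noetherian left_ideal.
  apply: catN.
    move=> x; exists [:: (left_ideal_val x, left_ideal_gen)].
    by rewrite big_seq1 left_ideal_genE.
  exists [:: left_ideal_gen] => N [_ _ NM] Ngen; rewrite -subTset => x _.
  by rewrite -(left_ideal_genE x); apply: NM; apply: Ngen; rewrite mem_head.
move=> J sJ Jchain.
pose N n : set left_ideal := [set x | forall r : R,
  exists2 j : corner e, J n j & val j = rmul (rmul e r) (val x)].
have NJ n (x : left_ideal) (j : corner e) : val x = val j -> N n x <-> J n j.
  move=> xj.
  have [ej je] := corner_set_unit (elimT (asboolP _) (corner_valP j)).
  split=> [/(_ e)[k Jk kE]|Jj r].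
    by suff -> : j = k by []; apply: val_inj; rewrite kE xj eI ej.
  have ere : corner_set e (rmul (rmul e r) e) by exists r.
  pose k : corner e := Corner (introT (asboolP _) ere).
  exists (rmul k j); last by rewrite /= -/(val j) xj -rmulA ej.
  by have [_ _] := sJ n; apply.
have [||n Hn] := noethRe N.
- move=> n; have [J0 JB JM] := sJ n; split.
  + by move=> r; exists 0 => //; rewrite rmulr0.
  + move=> x y Nx Ny r; have [j Jj jE] := Nx r; have [k Jk kE] := Ny r.
    by exists (j - k); [exact: JB|rewrite !raddfB /= -!/(val _) jE kE rmulBr].
  + move=> s x Nx r; have [j Jj jE] := Nx (rmul r s); exists j => //.
    by rewrite jE /= !rmulA.
- by move=> n x Nx r; have [j /Jchain] := Nx r; exists j.
exists n => m nm; apply/seteqP; split=> j Jj; last first.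
  by move: Jj; apply: chain_le.
have [_ je] := corner_set_unit (elimT (asboolP _) (corner_valP j)).
have jin : val j \in left_ideal_pred by rewrite inE je.
by apply/(NJ n (LeftIdeal jin)) => //; rewrite -(Hn m nm); apply/NJ.
Qed.

End PrincipalLeftIdeal.

(** * Subgroups of the integers and ideals of polynomials *)

(** The generator is the least positive element, or [0] if there is none. *)
Lemma int_subgroup_cyclic (H : set int) :
  H 0 -> (forall j k, H j -> H k -> H (j - k)) ->
  exists d : int, forall k, H k <-> exists j, k = j * d.
Proof.
move=> H0 HB.
have HN k : H k -> H (- k) by move=> Hk; rewrite -[- k]add0r; exact: HB.
have HD j k : H j -> H k -> H (j + k).
  by move=> Hj Hk; rewrite -[k]opprK; apply: HB => //; exact: HN.
have HM d j : H d -> H (j * d).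
  move=> Hd; have Hn (n : nat) : H (n%:Z * d).
    elim: n => [|n IHn]; first by rewrite mul0r.
    by rewrite -addn1 PoszD mulrDl mul1r; exact: HD.
  by case: j => n; rewrite ?NegzE ?mulNr; [exact: Hn|exact/HN/Hn].
have [[k [Hk k0]]|nH] := pselect (exists k, H k /\ k != 0); last first.
  exists 0 => k; split=> [Hk|[j ->]]; last by rewrite mulr0.
  exists 0; rewrite mulr0; have [//|k0] := eqVneq k 0.
  by case: nH; exists k.
have exn : exists n : nat, `[< H n.+1%:Z >].
  have [k_gt0|k_le0] := ltP 0 k.
    by exists `|k|.-1%N; apply/asboolP; have -> : `|k|.-1.+1%:Z = k by lia.
  exists `|k|.-1%N; apply/asboolP; have -> : `|k|.-1.+1%:Z = - k by lia.
  exact: HN.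
case: (ex_minnP exn) => n /asboolP Hn nmin; exists n.+1%:Z => j.
split=> [Hj|[i ->]]; last exact: HM.
exists (j %/ n.+1)%Z.
have jE := divz_eq j n.+1.
have r_ge0 : (0 <= (j %% n.+1)%Z)%R by exact: modz_ge0.
have r_lt : ((j %% n.+1)%Z < n.+1%:Z)%R by exact: ltz_pmod.
have Hr : H (j %% n.+1)%Z.
  have -> : (j %% n.+1)%Z = j - (j %/ n.+1)%Z * n.+1%:Z.
    by rewrite {2}jE addrAC subrr add0r.
  by apply: HB => //; exact: HM.
have [r0|r0] := eqVneq (j %% n.+1)%Z 0; first by rewrite {1}jE r0 addr0.
suff : (n <= `|(j %% n.+1)%Z|.-1)%N by lia.
apply: nmin; apply/asboolP.
by have -> : `|(j %% n.+1)%Z|.-1.+1%:Z = (j %% n.+1)%Z by lia.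
Qed.

(** A nonzero polynomial of least degree in the union of the chain divides all
    the others, so the chain is constant once it contains that polynomial. *)
Lemma poly_ideal_chain_stabilises (K : fieldType) (J : nat -> set {poly K}) :
  (forall n, J n 0) -> (forall n p q, J n p -> J n q -> J n (p - q)) ->
  (forall n p q, J n p -> J n (q * p)) ->
  (forall n, J n `<=` J n.+1) -> stabilises J.
Proof.
move=> J0 JB JM Jchain.
have [exg|nog] := pselect (exists k, `[< exists n g,
    [/\ J n g, g != 0 & size g = k] >]); last first.
  exists 0%N => m _ p Jp; have [->//|p0] := eqVneq p 0.
  by case: nog; exists (size p); apply/asboolP; exists m, p.
case: (ex_minnP exg) => _ /asboolP[n [g [Jg g0 <-]]] gmin.
exists n => m nm p Jp.
have Jr : J m (p %% g).
  have -> : p %% g = p - (p %/ g) * g.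
    by rewrite {2}(divp_eq p g) addrAC subrr add0r.
  by apply: JB => //; apply: JM; exact: chain_le nm _ Jg.
have [r0|r0] := eqVneq (p %% g) 0.
  by rewrite (divp_eq p g) r0 addr0; exact: JM.
have : (size g <= size (p %% g)%R)%N.
  by apply: gmin; apply/asboolP; exists m, (p %% g)%R.
by rewrite leqNgt ltn_modp g0.
Qed.

(** * Local units of the Steinberg algebra *)

Section Units.
Variable S : drSystem.
Local Notation G := (drGroupoid S).
Implicit Types (a b c : G) (E F U V : set G).

Lemma dr_unit_subproof (x : S) : `[< dr_arrow (x, 0, x) >].
Proof. by apply/asboolP; exists 0%N, 0%N; split. Qed.

Definition dr_unit (x : S) : G := DRGroupoid (dr_unit_subproof x).

Lemma dr_comp_unitl a : dr_comp (dr_unit (dr_rng a)) a a.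
Proof. by apply/dr_compE; split=> //; rewrite add0r. Qed.

Lemma dr_comp_unitr a : dr_comp a (dr_unit (dr_src a)) a.
Proof. by apply/dr_compE; split=> //; rewrite addr0. Qed.

Lemma dr_comp_inv_unit a : dr_comp a (dr_inv a) (dr_unit (dr_rng a)).
Proof. by apply/dr_compE; split=> //; rewrite {2}/dr_deg /= subrr. Qed.

Definition is_units E := forall a, E a -> a = dr_unit (dr_rng a).

Lemma is_units_src E a : is_units E -> E a -> dr_src a = dr_rng a.
Proof. by move=> uE Ea; rewrite {1}(uE a Ea). Qed.

Lemma is_units_bisection E : is_units E -> dr_bisection E.
Proof.
move=> uE; split=> a b /[!inE] Ea Eb ab.
  by rewrite (uE a Ea) (uE b Eb) ab.
by rewrite (uE a Ea) (uE b Eb) -(is_units_src uE Ea) -(is_units_src uE Eb) ab.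
Qed.

Lemma dr_setM_unitsl E U : is_units E ->
  (forall a, U a -> E (dr_unit (dr_rng a))) -> dr_setM E U = U.
Proof.
move=> uE EU; apply/seteqP; split=> [c [a [b [Ea Ub abc]]]|a Ua].
  suff -> : c = b by [].
  apply: (dr_comp_uniq abc); rewrite (uE a Ea).
  have /dr_compE[ab _ _ _] := abc.
  by rewrite -(is_units_src uE Ea) ab; exact: dr_comp_unitl.
exists (dr_unit (dr_rng a)), a; split=> //; first exact: EU.
exact: dr_comp_unitl.
Qed.

Lemma dr_setM_unitsr E U : is_units E ->
  (forall a, U a -> E (dr_unit (dr_src a))) -> dr_setM U E = U.
Proof.
move=> uE EU; apply/seteqP; split=> [c [a [b [Ua Eb abc]]]|a Ua].
  suff -> : c = a by [].
  apply: (dr_comp_uniq abc); rewrite (uE b Eb).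
  by have /dr_compE[<- _ _ _] := abc; exact: dr_comp_unitr.
exists a, (dr_unit (dr_src a)); split=> //; first exact: EU.
exact: dr_comp_unitr.
Qed.

Lemma dr_cob0 : dr_cob (set0 : set G).
Proof.
by split; [exact: compact0|exact: open0|split=> a b; rewrite inE].
Qed.

Lemma dr_cob_inv U : dr_cob U -> dr_cob (@dr_inv S @^-1` U).
Proof.
move=> [cU oU [rU sU]]; split.
- have -> : @dr_inv S @^-1` U = @dr_inv S @` U.
    apply/seteqP; split=> [a Ua|_ [a Ua <-]]; last by rewrite /= dr_invK.
    by exists (dr_inv a) => //; exact: dr_invK.
  apply: continuous_compact cU; apply: continuous_subspaceT.
  exact: dr_inv_continuous.
- exact: dr_inv_open.
- split=> a b /[!inE] Ua Ub ab; apply: (can_inj (@dr_invK S)).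
    by apply: sU; rewrite ?inE.
  by apply: rU; rewrite ?inE.
Qed.

Lemma dr_cob_unitsU E F : is_units E -> is_units F -> dr_cob E -> dr_cob F ->
  is_units (E `|` F) /\ dr_cob (E `|` F).
Proof.
move=> uE uF [cE oE _] [cF oF _].
have uEF : is_units (E `|` F) by move=> a [/uE|/uF].
split=> //; split; [exact: compactU|exact: openU|exact: is_units_bisection].
Qed.

(** For a bisection [U] the product of [U] and its inverse is the set of units
    at the ranges of [U].  Written as a product, it is compact and open because
    compact open bisections are closed under inverses and products. *)
Definition range_units U := dr_setM U (@dr_inv S @^-1` U).

Lemma range_units_cob U : dr_cob U -> dr_cob (range_units U).
Proof. by move=> cU; apply: dr_cobM => //; exact: dr_cob_inv. Qed.

Lemma range_units_is_units U : dr_bisection U -> is_units (range_units U).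
Proof.
move=> [rU sU] c [a [b [Ua /= Ub abc]]].
have /dr_compE[ab -> _ _] := abc; apply: (dr_comp_uniq abc).
suff -> : b = dr_inv a by exact: dr_comp_inv_unit.
rewrite -[b]dr_invK; congr dr_inv; apply: sU; rewrite ?inE//.
Qed.

Lemma range_unitsP U a : U a -> range_units U (dr_unit (dr_rng a)).
Proof.
move=> Ua; exists a, (dr_inv a); split=> //; first by rewrite /= dr_invK.
exact: dr_comp_inv_unit.
Qed.

Lemma dr_unit_continuous : continuous dr_unit.
Proof.
move=> x W Wx; have [[[[U m] n] V] [Zi Zx ZW]] := dr_nbhsP Wx.
have [[oU oV] _ _ _ _] := Zi; have [Ux Vx mn _] := Zx.
have : nbhs x (U `&` V) by apply: open_nbhs_nbhs; split; [exact: openI|].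
apply: filterS => y [Uy Vy]; apply: ZW; split=> //.
by congr (dr_iter _ y); move: mn; rewrite /dr_deg /=; lia.
Qed.

Lemma dr_unit_cob (C : set S) : compact C -> open C -> dr_cob (dr_unit @` C).
Proof.
move=> cC oC; have uC : is_units (dr_unit @` C) by move=> _ [x _ <-].
split; last exact: is_units_bisection.
  apply: continuous_compact cC; apply: continuous_subspaceT.
  exact: dr_unit_continuous.
have -> : dr_unit @` C = dr_Zset (C, 0%N, 0%N, C).
  apply/seteqP; split=> [_ [x Cx <-]|a [Ca _ da ea]]; first by split.
  by exists (dr_rng a) => //; apply: dr_val_eq.
apply: dr_Zset_open; have hC : homeo_onto_image (dr_iter 0) C.
  by apply: dr_iter_homeo.
by split.
Qed.

End Units.

Section LocalUnits.
Variables (K : fieldType) (S : drSystem).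
Local Notation G := (drGroupoid S).
Local Notation A := (steinberg K S).
Implicit Types (E F U V : set G).

Definition cob_indic U (cU : dr_cob U) : A :=
  Steinberg (introT (asboolP _) (steinberg_indic K cU)).

Lemma cob_indic_units_idem E (cE : dr_cob E) : is_units E ->
  rmul (cob_indic cE) (cob_indic cE) = cob_indic cE.
Proof.
move=> uE; apply: val_inj; rewrite /= dr_conv_indic// dr_setM_unitsl//.
by move=> a Ea; rewrite -uE.
Qed.

(** A set of units that contains the units at the ranges and sources of [U] is
    neutral for [U].  The claim is made for all larger sets [F] so that the
    sets obtained for several functions can be united. *)
Lemma steinberg_fun_local_unit (f : G -> K) : steinberg_set f ->
  exists E, [/\ dr_cob E, is_units E & forall F, dr_cob F -> is_units F ->
    E `<=` F -> dr_conv \1_F f = f /\ dr_conv f \1_F = f].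
Proof.
move: f; apply: steinberg_ind.
  exists set0; split; [exact: dr_cob0|by []|].
  by move=> F _ _ _; rewrite dr_conv0l dr_conv0r.
move=> k U f cU fS [E [cE uE EP]].
have bU : dr_bisection U by case: cU.
have cU' := dr_cob_inv cU.
have bU' : dr_bisection (@dr_inv S @^-1` U) by case: cU'.
have [uR cR] := dr_cob_unitsU (range_units_is_units bU)
  (range_units_is_units bU') (range_units_cob cU) (range_units_cob cU').
have [uER cER] := dr_cob_unitsU uE uR cE cR.
eexists; split; [exact: cER|exact: uER|move=> F cF uF ERF].
have [Ff fF] : dr_conv \1_F f = f /\ dr_conv f \1_F = f.
  by apply: EP => // a Ea; apply: ERF; left.
have FS := steinberg_indic K cF; have US := steinberg_indic K cU.
split.
  rewrite dr_convZDr// Ff dr_conv_indic// dr_setM_unitsl// => a Ua.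
  by apply: ERF; right; left; exact: range_unitsP.
rewrite dr_convZDl// fF dr_conv_indic// dr_setM_unitsr// => a Ua.
apply: ERF; right; right; apply: (@range_unitsP _ _ (dr_inv a)).
by rewrite /= dr_invK.
Qed.

Lemma steinberg_local_unit (s : seq A) : exists E (cE : dr_cob E), is_units E /\
  forall f, f \in s -> rmul (cob_indic cE) f = f /\ rmul f (cob_indic cE) = f.
Proof.
suff [E [cE uE EP]] : exists E, [/\ dr_cob E, is_units E &
    forall F (cF : dr_cob F), is_units F -> E `<=` F -> forall f : A, f \in s ->
      rmul (cob_indic cF) f = f /\ rmul f (cob_indic cF) = f].
  by exists E, cE; split=> //; exact: EP.
elim: s => [|f s [E [cE uE EP]]].
  by exists set0; split=> //; exact: dr_cob0.
have [E' [cE' uE' E'P]] :=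
  steinberg_fun_local_unit (elimT (asboolP _) (steinberg_valP f)).
have [uEE cEE] := dr_cob_unitsU uE uE' cE cE'.
eexists; split; [exact: cEE|exact: uEE|move=> F cF uF EEF g].
rewrite inE => /orP[/eqP ->|gs]; last first.
  by apply: EP => // a Ea; apply: EEF; left.
have [Ff fF] := E'P F cF uF (subset_trans (@subsetUr _ _ _) EEF).
by split; apply: val_inj.
Qed.

Lemma categorically_locally_noetherian :
  categorically_noetherian A -> locally_noetherian A.
Proof.
move=> catA s; have [E [cE [uE Es]]] := steinberg_local_unit s.
exists (cob_indic cE); have idE := cob_indic_units_idem cE uE.
split=> // [f fs|]; last exact: noetherian_corner.
by have [] := Es f fs; exact: corner_setP.
Qed.

End LocalUnits.

Section NonDiscrete.
Variables (K : fieldType) (S : drSystem).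
Hypothesis tdS : totally_disconnected [set: S].
Local Notation A := (steinberg K S).

(** If the point [x] is not open, its compact open neighbourhoods can be shrunk
    forever: [V n] is a strictly decreasing sequence of them, and the functions
    in the corner that vanish on the arrows with source in [V n] form a strictly
    increasing sequence of left ideals. *)
Lemma locally_noetherian_discrete : locally_noetherian A -> discrete_space S.
Proof.
move=> locA; apply: discrete_space_singletons => x; apply: contrapT => nox.
have lcS := @dr_locally_compact S; have hS := @dr_hausdorff S.
pose good (V : set S) := [/\ compact V, open V & V x].
have [U [cU oU Ux _]] := compact_open_nbhs lcS hS tdS (@filterT _ (nbhs x) _).
have shrink (V : set S) : exists V', good V ->
    [/\ good V', V' `<=` V & exists2 y, V y & ~ V' y].
  have [[cV oV Vx]|] := pselect (good V); last by exists V.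
  have [y [Vy yx]] : exists y, V y /\ y <> x.
    apply: contrapT => noy; apply: nox; suff -> : [set x] = V by [].
    apply/seteqP; split=> [_ ->//|y Vy]; apply: contrapT => yx.
    by apply: noy; exists y.
  have [V' [cV' oV' V'x V'V]] : exists C : set S,
      [/\ compact C, open C, C x & C `<=` V `&` ~` [set y]].
    apply: compact_open_nbhs => //; apply: open_nbhs_nbhs; split.
      apply: openI => //; apply: closed_openC; apply: compact_closed => //.
      exact: compact_set1.
    by split=> // /esym.
  exists V'; split=> //; first by move=> z /V'V[].
  by exists y => // /V'V[_]; apply.
pose next V := projT1 (cid (shrink V)).
pose V n := iter n next U.
have Vgood n : good (V n).
  by elim: n => [|n IHn] //=; have [] := projT2 (cid (shrink (V n))) IHn.
have Vnext n : V n.+1 `<=` V n /\ exists2 y, V n y & ~ V n.+1 y.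
  by have [] := projT2 (cid (shrink (V n))) (Vgood n).
have VU n : V n `<=` U.
  by elim: n => // n IHn; apply: subset_trans IHn; have [] := Vnext n.
pose u : A := cob_indic K (dr_unit_cob cU oU).
have [e [eI eu noethe]] := locA [:: u].
have [eul eur] : rmul e u = u /\ rmul u e = u.
  by apply: (corner_set_unit eI); apply: eu; rewrite mem_head.
pose J n : set (regular_module (corner e)) :=
  [set f | forall a, V n (dr_src a) -> val (val (f : corner e)) a = 0].
have [||n Jn] := noethe J.
- move=> n; split=> //.
  + move=> f g Jf Jg a Va.
    rewrite (_ : val _ a =
      val (val (f : corner e)) a - val (val (g : corner e)) a)//.
    by rewrite Jf// Jg// subrr.
  + move=> r f Jf a Va; apply: fsbig1 => -[b c] /= /dr_compE[_ _ _ sa].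
    by rewrite Jf ?mulr0// -sa.
- by move=> n f Jf a Va; apply: Jf; have [VV _] := Vnext n; exact: VV.
have [VV [y Vy nVy]] := Vnext n.
pose W := V n `\` V n.+1.
have clV m : closed (V m) by apply: compact_closed => //; have [] := Vgood m.
have oW : open W.
  by apply: openI; [have [] := Vgood n|exact: closed_openC].
have cW : compact W.
  apply: (@subclosed_compact _ _ (V n)).
  - by apply: closedI => //; apply: open_closedC; have [] := Vgood n.+1.
  - by have [] := Vgood n.
  - by move=> z [].
pose w : A := cob_indic K (dr_unit_cob cW oW).
have uS (C : set S) : is_units (@dr_unit S @` C) by move=> _ [z _ <-].
have [uw wu] : rmul u w = w /\ rmul w u = w.
  have cU' := dr_unit_cob cU oU; have cW' := dr_unit_cob cW oW.
  have WU a : (@dr_unit S @` W) a -> (@dr_unit S @` U) a.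
    by move=> [z [/VU Uz _] <-]; exists z.
  have [uU uW] := (uS U, uS W).
  split; apply: val_inj; rewrite /= dr_conv_indic//.
    by rewrite dr_setM_unitsl// => a Wa; rewrite -uW//; exact: WU.
  rewrite dr_setM_unitsr// => a Wa; rewrite (is_units_src uW Wa) -uW//.
  exact: WU.
(* The indicator [w] vanishes on the arrows with source in [V n.+1], but not on
   the unit at [y], whose source lies in [V n]. *)
have ew : corner_set e w.
  by apply: corner_setP; [rewrite -uw rmulA eul|rewrite -wu -rmulA eur].
pose cw : corner e := Corner (introT (asboolP _) ew).
have /= : J n.+1 cw.
  move=> a Va; rewrite /= indicE memNset// => -[z [_ nVz] za].
  by apply: nVz; move: Va; rewrite -za.
rewrite Jn// => /(_ (dr_unit y) Vy); rewrite /= indicE mem_set; last first.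
  by exists y.
by move/eqP; rewrite oner_eq0.
Qed.

End NonDiscrete.

(** * Steinberg algebras of discrete groupoids *)

Lemma rmul_suml (R : rngType) I (s : seq I) (F : I -> R) x :
  rmul (\sum_(i <- s) F i) x = \sum_(i <- s) rmul (F i) x.
Proof. exact: (big_morph (rmul^~ x) (fun a b => rmulDl a b x) (rmul0r x)). Qed.

Lemma rmul_sumr (R : rngType) I (s : seq I) (F : I -> R) x :
  rmul x (\sum_(i <- s) F i) = \sum_(i <- s) rmul x (F i).
Proof. exact: (big_morph (rmul x) (fun a b => rmulDr x a b) (rmulr0 x)). Qed.

Section Isotropy.
Variables (S : drSystem) (x : S).
Local Notation G := (drGroupoid S).

Lemma dr_valE (a : G) : dr_val a = (dr_rng a, dr_deg a, dr_src a).
Proof. by rewrite /dr_rng /dr_deg /dr_src; case: (dr_val a) => -[]. Qed.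

(** An arrow from [x] to [x] is determined by its degree, and the degrees form a
    subgroup of the integers.  The parametrisation [g] of the isotropy group is
    not injective when that subgroup is zero. *)
Lemma isotropy_cyclic : exists g : int -> G,
  [/\ forall j, dr_rng (g j) = x /\ dr_src (g j) = x, g 0 = dr_unit x,
      forall i j, dr_comp (g i) (g j) (g (i + j))
    & forall a, dr_rng a = x -> dr_src a = x -> exists j, a = g j].
Proof.
have [|j k [a aE] [b bE]|d dP] := @int_subgroup_cyclic
  [set k | exists a : G, dr_val a = (x, k, x)].
- by exists (dr_unit x).
- have [|c [_ cE]] := @dr_comp_ex _ a (dr_inv b).
    by rewrite /dr_src /dr_rng /= /dr_src aE bE.
  exists c.
  by rewrite cE /dr_rng /dr_src /dr_deg /= /dr_rng /dr_src /dr_deg aE bE.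
have gP j : exists a : G, dr_val a = (x, j * d, x) by apply/dP; exists j.
exists (fun j => projT1 (cid (gP j))).
have gE j : dr_val (projT1 (cid (gP j))) = (x, j * d, x).
  exact: (projT2 (cid (gP j))).
split=> [j||i j|a ra sa].
- by rewrite /dr_rng /dr_src gE.
- by apply: val_inj; rewrite /= gE mul0r.
- by split; rewrite /dr_src /dr_rng /dr_deg !gE //= mulrDl.
- have [|j jE] := (dP (dr_deg a)).1.
    by exists a; rewrite dr_valE ra sa.
  by exists j; apply: val_inj; rewrite /= gE -jE dr_valE ra sa.
Qed.

End Isotropy.

Section Discrete.
Variables (K : fieldType) (S : drSystem).
Local Notation G := (drGroupoid S).
Local Notation A := (steinberg K S).
Hypothesis discG : discrete_space G.

Lemma discrete_cob1 (a : G) : dr_cob [set a].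
Proof.
by split; [exact: compact_set1|exact: discG|split=> b c /[!inE] -> ->].
Qed.

Lemma point_mass_subproof (k : K) (a : G) :
  (fun b => k * \1_[set a] b) \in @steinberg_pred K S.
Proof.
apply/asboolP; exists [:: (k, [set a])]; split.
  by move=> p /[!inE] /eqP ->; exact: discrete_cob1.
by move=> b; rewrite big_seq1.
Qed.

Definition point_mass k a : A := Steinberg (point_mass_subproof k a).
Lemma point_mass0 a : point_mass 0 a = 0.
Proof. by apply/val_inj/funext => b /=; rewrite mul0r. Qed.

Lemma point_massB k l a :
  point_mass (k - l) a = point_mass k a - point_mass l a.
Proof. by apply/val_inj/funext => b /=; exact: mulrBl. Qed.

Lemma dr_convZ k l (f g : G -> K) : steinberg_set f -> steinberg_set g ->
  dr_conv (fun a => k * f a) (fun a => l * g a) =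
  (fun a => k * l * dr_conv f g a).
Proof.
move=> fS gS.
have E k' (h : G -> K) :
    (fun a => k' * h a) = (fun a => k' * h a + (0 : G -> K) a).
  by apply/funext => a; rewrite addr0.
have S0 := steinberg_set0 K S.
rewrite (E k f) dr_convZDl// dr_conv0l (E l g) dr_convZDr// dr_conv0r.
by apply/funext => a; rewrite !addr0 mulrA.
Qed.

Lemma point_massM k l a b c : dr_comp a b c ->
  rmul (point_mass k a) (point_mass l b) = point_mass (k * l) c.
Proof.
move=> abc; apply: val_inj => /=.
have aS := steinberg_indic K (discrete_cob1 a).
have bS := steinberg_indic K (discrete_cob1 b).
rewrite dr_convZ// dr_conv_indic; [|exact: discrete_cob1..].
suff -> : dr_setM [set a] [set b] = [set c] by [].
apply/seteqP; split=> [_ [_ [_ [-> -> /(dr_comp_uniq abc) ->]]]//|_ ->].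
by exists a, b.
Qed.

Lemma point_massM0 k l a b : dr_src a <> dr_rng b ->
  rmul (point_mass k a) (point_mass l b) = 0.
Proof.
move=> ab; apply: val_inj => /=.
have aS := steinberg_indic K (discrete_cob1 a).
have bS := steinberg_indic K (discrete_cob1 b).
rewrite dr_convZ// dr_conv_indic; [|exact: discrete_cob1..].
rewrite (_ : dr_setM _ _ = set0).
  by apply/funext => c; rewrite indic0 mulr0.
by rewrite -subset0 => c [a1 [b1 [-> -> []]]].
Qed.

Lemma steinberg_val_sum I (s : seq I) (F : I -> A) a :
  val (\sum_(i <- s) F i) a = \sum_(i <- s) val (F i) a.
Proof. by elim/big_rec2: _ => //= i f g _ <-. Qed.

Lemma cob_indic_point_masses U (cU : dr_cob U) : exists s : seq G,
  (forall a, a \in s -> U a) /\ cob_indic K cU = \sum_(a <- s) point_mass 1 a.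
Proof.
have [cpU _ _] := cU.
have /finite_seqP[s UE] := discrete_compact_finite discG cpU.
exists (undup s); split=> [a|]; first by rewrite mem_undup UE.
apply/val_inj/funext => a; rewrite steinberg_val_sum /= indicE UE.
have [as_|as_] := boolP (a \in s); last first.
  rewrite memNset; last exact/negP.
  rewrite big_seq big1// => b; rewrite mem_undup => bs.
  by rewrite indicE memNset ?mulr0// => ab; move: as_; rewrite ab bs.
rewrite mem_set// (bigD1_seq a) ?undup_uniq ?mem_undup//=.
rewrite indicE mem_set// mulr1 big1 ?addr0// => b ba.
by rewrite indicE memNset ?mulr0// => ab; rewrite ab eqxx in ba.
Qed.

Lemma point_masses_span (f : A) : exists s : seq (K * G),
  f = \sum_(p <- s) point_mass p.1 p.2.
Proof.
suff H : forall h : G -> K, steinberg_set h -> exists s : seq (K * G),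
    h = \sum_(p <- s) val (point_mass p.1 p.2).
  have [s fE] := H f (elimT (asboolP _) (steinberg_valP f)); exists s.
  apply/val_inj/funext => a; rewrite steinberg_val_sum /= fE.
  by elim/big_rec2: _ => //= i u v _ <-.
apply: steinberg_ind; first by exists [::]; rewrite big_nil.
move=> k U h cU _ [s hE]; have [t [_ UE]] := cob_indic_point_masses cU.
exists ([seq (k, a) | a <- t] ++ s).
rewrite big_cat big_map -hE; apply/funext => a.
have /= -> := congr1 (fun f : A => val f a) UE.
rewrite steinberg_val_sum mulr_sumr; congr (_ + _).
by elim/big_rec2: _ => //= i u v _ ->; rewrite mul1r.
Qed.

Section IsotropyCorner.
Variable x : S.
Local Notation e := (point_mass 1 (dr_unit x)).

Lemma point_mass_unit_idem : rmul e e = e.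
Proof. by rewrite (point_massM 1 1 (dr_comp_unitl (dr_unit x))) mulr1. Qed.

Lemma point_mass_unit_corner y k a :
  rmul (point_mass 1 (dr_unit y)) (rmul (point_mass k a) e) =
  if `[< dr_rng a = y /\ dr_src a = x >] then point_mass k a else 0.
Proof.
have [sa|sa] := pselect (dr_src a = x); last first.
  by rewrite point_massM0// rmulr0 asboolF// => -[].
have [ra|ra] := pselect (dr_rng a = y); last first.
  rewrite -sa (point_massM _ _ (dr_comp_unitr a)) point_massM0; last first.
    by move=> /esym.
  by rewrite asboolF// => -[].
rewrite asboolT// -sa (point_massM _ _ (dr_comp_unitr a)) -ra.
by rewrite (point_massM _ _ (dr_comp_unitl a)) mul1r mulr1.
Qed.

Variable g : int -> G.
Hypothesis g0 : g 0 = dr_unit x.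
Hypothesis gD : forall i j, dr_comp (g i) (g j) (g (i + j)).
Hypothesis gP : forall a, dr_rng a = x -> dr_src a = x -> exists j, a = g j.

Implicit Types p q : {poly K}.

(** The evaluation of [p] at the generator [g 1] of the isotropy group, in the
    group algebra of that group. *)
Definition poly_mass (p : {poly K}) : A :=
  \sum_(i < size p) point_mass p`_i (g i%:Z).

Lemma poly_massE n p : (size p <= n)%N ->
  poly_mass p = \sum_(i < n) point_mass p`_i (g i%:Z).
Proof.
move=> pn; rewrite /poly_mass.
rewrite (big_ord_widen n (fun i => point_mass p`_i (g i%:Z)))//.
rewrite big_mkcond; apply: eq_bigr => i _; case: ltnP => // pi.
by rewrite nth_default// point_mass0.
Qed.

Lemma poly_mass0 : poly_mass 0 = 0.
Proof. by rewrite /poly_mass size_poly0 big_ord0. Qed.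

Lemma poly_massB p q : poly_mass (p - q) = poly_mass p - poly_mass q.
Proof.
pose n := maxn (size p) (size q).
rewrite (@poly_massE n p) ?leq_maxl// (@poly_massE n q) ?leq_maxr//.
rewrite (@poly_massE n (p - q)); last first.
  by rewrite (leq_trans (size_polyD _ _)) ?size_polyN.
by rewrite -sumrB; apply: eq_bigr => i _; rewrite coefB point_massB.
Qed.

Lemma poly_massD p q : poly_mass (p + q) = poly_mass p + poly_mass q.
Proof.
have massN : poly_mass (- q) = - poly_mass q.
  by rewrite -sub0r poly_massB poly_mass0 sub0r.
by rewrite -[q in LHS]opprK poly_massB massN opprK.
Qed.

Lemma poly_massZ c p :
  poly_mass (c *: p) = rmul (point_mass c (dr_unit x)) (poly_mass p).
Proof.
rewrite (@poly_massE (size p) (c *: p)) ?size_scale_leq// rmul_sumr.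
apply: eq_bigr => i _; rewrite coefZ -g0.
by have := gD 0 i%:Z; rewrite add0r => /point_massM ->.
Qed.

Lemma poly_massX p :
  poly_mass (p * 'X) = rmul (point_mass 1 (g 1)) (poly_mass p).
Proof.
rewrite (@poly_massE (size p).+1); last first.
  by rewrite (leq_trans (size_polyMleq _ _)) // size_polyX addn2.
rewrite big_ord_recl coefMX /= point_mass0 add0r rmul_sumr.
apply: eq_bigr => i _; rewrite coefMX /= (point_massM _ _ (gD 1 i%:Z)) mul1r.
by congr (point_mass _ (g _)); rewrite /bump /=; lia.
Qed.

Lemma poly_massXn c n : poly_mass (c *: 'X^n) = point_mass c (g n%:Z).
Proof.
rewrite (@poly_massE n.+1); last first.
  by rewrite (leq_trans (size_scale_leq _ _))// size_polyXn.
rewrite big_ord_recr /= coefZ coefXn eqxx mulr1 big1 ?add0r// => i _.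
by rewrite coefZ coefXn ltn_eqF// mulr0 point_mass0.
Qed.

(** Compressing by [e] only keeps the masses at isotropy arrows [g j], and
    multiplying by a high power of [g 1] makes all the [j] nonnegative. *)
Lemma corner_shift_poly (s : seq (K * G)) :
  exists N : nat, forall n, (N <= n)%N -> exists p, rmul (point_mass 1 (g n%:Z))
    (rmul e (rmul (\sum_(q <- s) point_mass q.1 q.2) e)) = poly_mass p.
Proof.
elim: s => [|[k a] s [N IHs]].
  by exists 0%N => n _; exists 0; rewrite big_nil poly_mass0 rmul0r !rmulr0.
have [[ra sa]|na] := pselect (dr_rng a = x /\ dr_src a = x).
  have [j aj] := gP ra sa; exists (maxn N `|j|%N) => n.
  rewrite geq_max => /andP[Nn jn].
  have [p pE] := IHs n Nn.
  exists (k *: 'X^(absz (n%:Z + j)) + p).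
  rewrite big_cons rmulDl !rmulDr pE poly_massD; congr (_ + _).
  rewrite point_mass_unit_corner asboolT// poly_massXn aj.
  rewrite (point_massM _ _ (gD _ _)) mul1r.
  by congr (point_mass _ (g _)); lia.
exists N => n /IHs[p pE]; exists p; rewrite big_cons rmulDl !rmulDr pE.
by rewrite point_mass_unit_corner asboolF// rmulr0 add0r.
Qed.

End IsotropyCorner.

(** A chain [J] is controlled by the ideals [P] of the polynomials whose value
    at the generator [g 1] lies in [J].  To see that [f] in [J m] lies in [J n],
    decompose [f] into its parts [e_y f].  Such a part vanishes if no arrow [b]
    leads from [x] to [y]; otherwise it is [1_b] times an element [h] of
    [e_x A e_x], and a translate of [h] is a polynomial. *)
Lemma noetherian_below_unit x : noetherian_below (point_mass 1 (dr_unit x)).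
Proof.
have [g [gx g0 gD gP]] := isotropy_cyclic x.
move=> J sJ Jchain Je.
pose P n : set {poly K} := [set p | J n (poly_mass g p)].
have [||n q p Pq||n Hn] := poly_ideal_chain_stabilises (J := P).
- by move=> n; rewrite /P /= poly_mass0; have [] := sJ n.
- by move=> n p q; rewrite /P /= poly_massB; have [_ + _] := sJ n; apply.
- have [_ _ JM] := sJ n.
  elim/poly_ind: p => [|p c IHp].
    by rewrite mul0r /P /= poly_mass0; have [] := sJ n.
  rewrite mulrDl mulrAC mul_polyC /P /= poly_massD.
  rewrite (poly_massX gD) (poly_massZ g0 gD).
  exact: (submoduleD (sJ n) (JM _ _ IHp) (JM _ _ Pq)).
- by move=> n p; exact: Jchain.
exists n => m nm f Jf; have [_ _ JM] := sJ m; have [J0 _ JnM] := sJ n.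
have [E [cE [uE EP]]] := steinberg_local_unit [:: f].
have [t [tE tsum]] := cob_indic_point_masses cE.
have [<- _] := EP f (mem_head _ _).
rewrite tsum rmul_suml; apply: (submodule_sum (sJ n)) => a /tE /uE ->.
set y := dr_rng a.
have [[b [rb sb]]|nob] :=
  pselect (exists b : G, dr_rng b = y /\ dr_src b = x); last first.
  have [s fE] := point_masses_span f.
  suff -> : rmul (point_mass 1 (dr_unit y)) f = 0 by [].
  rewrite -(Je m f Jf) fE rmul_suml rmul_sumr big1// => -[k c] _ /=.
  by rewrite point_mass_unit_corner asboolF// => cyx; apply: nob; exists c.
have := dr_comp_inv_unit b; rewrite rb => /point_massM bM.
rewrite -[1]mulr1 -bM -rmulA; apply: (JnM).
set h := rmul _ f; have Jh : J m h by exact: JM.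
have eh : rmul (point_mass 1 (dr_unit x)) h = h.
  have := dr_comp_unitl (dr_inv b); rewrite [dr_rng _]sb => /point_massM cM.
  by rewrite /h rmulA cM mulr1.
have [s hE] := point_masses_span h.
have [N NP] := corner_shift_poly gD gP s.
have [p pE] := NP N (leqnn _).
rewrite -hE (Je m h Jh) eh in pE.
have Pp : P n p by apply: (Hn m nm p); rewrite /P /= -pE; exact: JM.
have := gD (- N%:Z) N%:Z; rewrite addNr g0 => /point_massM gM.
by rewrite -eh -[1]mulr1 -gM -rmulA pE; exact: JnM.
Qed.

(** As the module is unital, a local unit fixes the given generators; it is a
    finite sum of idempotents [e_y], so the elements [e_y z], for [z] a given
    generator, generate the module too. *)
Lemma discrete_categorically_noetherian : categorically_noetherian A.
Proof.
move=> M uM [gens gensP].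
have [fs fsP] : exists fs : seq A, forall e,
    (forall f, f \in fs -> rmul e f = f) ->
    forall z : M, z \in gens -> ract e z = z.
  elim: gens {gensP} => [|z gens [fs fsP]]; first by exists [::].
  have [r zE] := uM z; exists ([seq p.1 | p <- r] ++ fs) => e eP z'.
  rewrite inE => /orP[/eqP -> {z'}|]; last first.
    by apply: fsP => f ffs; apply: eP; rewrite mem_cat ffs orbT.
  rewrite {2}zE zE ract_sumr; apply: eq_big_seq => p pr; rewrite ractA eP//.
  by rewrite mem_cat map_f.
have [E [cE [uE EP]]] := steinberg_local_unit fs.
have [t [tE tsum]] := cob_indic_point_masses cE.
have fixg := fsP _ (fun f ffs => (EP f ffs).1).
apply: (@noetherian_of_generators _ _
  [seq (point_mass 1 a, ract (point_mass 1 a) z) | z <- gens, a <- t]).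
  move=> _ /allpairsP[[z a] [/= _ /tE /uE -> ->]] /=.
  rewrite ractA point_mass_unit_idem; split=> //.
  exact: noetherian_below_unit.
move=> N sN NP; apply: gensP => // z zg; rewrite -(fixg z zg) tsum ract_suml.
apply: submodule_sum => // a at_.
by apply: (NP (point_mass 1 a, _)); apply/allpairsP; exists (z, a).
Qed.

End Discrete.

Lemma discrete_groupoid (S : drSystem) :
  discrete_space S -> discrete_space (drGroupoid S).
Proof.
move=> discS; apply: discrete_space_singletons => a.
have [m [n [da ma na ea]]] := dr_arrow_val a.
have o1 (y : S) : nbhs y [set y] by apply: open_nbhs_nbhs; split.
have [U [V [UV Za Ua Va]]] := dr_Zset_around da ma na ea (o1 _) (o1 _).
suff <- : dr_Zset (U, m, n, V) = [set a] by exact: dr_Zset_open.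
apply/seteqP; split=> [b [/Ua rb /Va sb db _]|_ ->//].
by apply: dr_val_eq; rewrite ?rb ?sb ?db.
Qed.

Theorem proposition6p11 (K : fieldType) (S : drSystem)
    (S_totally_disconnected : totally_disconnected [set: S]) :
  [<-> discrete_space S;
       discrete_space (drGroupoid S);
       categorically_noetherian (steinberg K S);
       locally_noetherian (steinberg K S)].
Proof.
split; first exact: discrete_groupoid.
split; first exact: discrete_categorically_noetherian.
split; first exact: categorically_locally_noetherian.
exact: locally_noetherian_discrete.
Qed.
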